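(* Let $\mathfrak g=\mathfrak{so}(2r+1)$, $r\geq2$, let $\lambda$ be a dominant integral weight, $\boldsymbol\Lambda=(\lambda,\omega_1)$, $\boldsymbol z=(0,1)$, and let $\boldsymbol l$ be an admissible $r$-tuple of length $l\neq r$. Let the $r$-tuple $\boldsymbol y$ represent the solution of the Bethe ansatz equation associated to $\boldsymbol\Lambda,\boldsymbol z,\boldsymbol l$. Then $$D_\lambda(\boldsymbol y)=D_\lambda\big(x^{a_\lambda^l(1)},\dots,x^{a_\lambda^l(r)}\big).$$
   Context: Type $\mathrm B_r$ conventions: simple roots $\alpha_1,\dots,\alpha_r$ (standard numbering), coroots $\alpha_i^\vee$, fundamental weights $\omega_i$; $(\alpha_i,\alpha_i)=4$ for $i<r$, $(\alpha_r,\alpha_r)=2$; $\lambda_i=\langle\lambda,\alpha_i^\vee\rangle$. Bethe ansatz equation. Given weights $\boldsymbol\Lambda=(\Lambda_1,\dots,\Lambda_n)$, distinct complex numbers $\boldsymbol z$ and nonnegative integers $\boldsymbol l=(l_1,\dots,l_r)$ with $l=\sum l_i$, let $c:\{1,\dots,l\}\to\{1,\dots,r\}$ be non-decreasing with $\#c^{-1}(i)=l_i$. The equation is $$-\sum_{s=1}^n\frac{(\alpha_{c(i)},\Lambda_s)}{t_i-z_s}+\sum_{j\ne i}\frac{(\alpha_{c(i)},\alpha_{c(j)})}{t_i-t_j}=0,\quad i=1,\dots,l$$ (terms with zero numerator omitted, other denominators nonzero; solutions are considered up to permutations preserving $c$). A solution is represented by $\boldsymbol y=(y_1,\dots,y_r)$,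 $y_i=\prod_{c(j)=i}(x-t_j)$. The tuple $\boldsymbol l$ is admissible if $V_{\lambda+\omega_1-\sum l_i\alpha_i}$ is a summand of $V_\lambda\otimes V_{\omega_1}$. Admissible tuples have the form $(1,\dots,1,0,\dots,0)$ or $(1,\dots,1,2,\dots,2)$ and are determined by their length $l\in\{0,\dots,2r\}$; such a tuple of length $l$ is admissible iff $l=0$, or $1\le l\leq r$ and $\lambda_l>0$, or $l=r+1$ and $\lambda_r>1$, or $r+1<l\leq2r$ and $\lambda_{2r-l+1}>0$. For admissible tuples the Bethe ansatz equation with these data has exactly one solution. Differential operator. Let $T_1=x^{\lambda_1}(x-1)$ and $T_i=x^{\lambda_i}$ for $2\leq i\leq r$. Put $\partial=d/dx$, $\ln'f=f'/f$. For an $r$-tuple $\boldsymbol y$ of quasi-polynomials (functions $x^ap(x)$ with $a\in\mathbb C$, $p\in\mathbb C[x]$), with $y_0:=1$, define the order $2r$ operator $$D_\lambda(\boldsymbol y)=\overrightarrow{\prod_{i=1}^{r}}\Big(\partial-\ln'\frac{y_{i-1}\,T_1^2\cdots T_{r-1}^2T_r}{y_i\,T_1\cdots T_{i-1}}\Big)\cdot\overrightarrow{\prod_{i=r,r-1,\dots,1}}\Big(\partial-\ln'\frac{y_i\,T_1\cdots T_{i-1}}{y_{i-1}}\Big),$$ where factors are ordered left to right with $i=1,2,\dots,r$ in the first product and $i=r,r-1,\dots,1$ in the second (so the last factor is $\partial-\ln'y_1$). Exponents. For $0\leq l\leq r-1$: $a_\lambda^l(i)=\lambda_i+\dots+\lambda_l+l+1-i$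 for $1\leq i\leq l$, and $a_\lambda^l(i)=0$ for $l+1\leq i\leq r$. For $r+1\leq l\leq2r$, with $k=2r-l$: $a_\lambda^l(i)=\lambda_i+\dots+\lambda_k+2\lambda_{k+1}+\dots+2\lambda_{r-1}+\lambda_r+2r-k-i$ for $1\leq i\leq k$, and $a_\lambda^l(i)=2\lambda_{k+1}+\dots+2\lambda_{r-1}+\lambda_r+2r-2k-1$ for $k+1\leq i\leq r$. *)

(* Defs.v *)
From mathcomp Require Import all_boot all_order all_algebra.
From mathcomp Require Import complex mxtens reals ring.

Set Implicit Arguments.
Unset Strict Implicit.
Unset Printing Implicit Defensive.

Import GRing.Theory.
Local Open Scope ring_scope.

(* f_i with i in {1, ..., r}, for a tuple f stored over 'I_r = {0, ..., r-1};
   x0 is the value for every other i, in particular for i = 0. *)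
Definition at1 (T : Type) (x0 : T) (r : nat) (f : 'I_r -> T) (i : nat) : T :=
  if i is j.+1 then oapp f x0 (insub j) else x0.

(* A weight mu is given by its coordinates <mu, alpha_i^vee>. *)
Definition weight (r : nat) := 'I_r -> int.

Definition dominant_weight (r : nat) (lam : 'I_r -> nat) : weight r :=
  fun i => (lam i)%:Z.

(* <alpha_j, alpha_i^vee>; the entry -2 is <alpha_{r-1}, alpha_r^vee>. *)
Definition simple_root (r : nat) (j : 'I_r) : weight r := fun i =>
  if i == j then 2
  else if (i == j.+1 :> nat) then (if i.+1 == r then -2 else -1)
  else if (j == i.+1 :> nat) then -1
  else 0.

Definition omega1 (r : nat) : weight r := fun i => ((i : nat) == 0)%:Z.

(* (alpha_i, mu) = (alpha_i, alpha_i) / 2 * <mu, alpha_i^vee>, where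
   (alpha_i, alpha_i) = 4 for i < r and (alpha_r, alpha_r) = 2. *)
Definition root_pairing (r : nat) (i : 'I_r) (mu : weight r) : int :=
  (if i.+1 == r then 1 else 2) * mu i.

Section OddOrthogonal.
Variables (F : fieldType) (r : nat).

Local Notation M := 'M[F]_((r.*2).+1).

(* so(2r+1) is taken with respect to the antidiagonal symmetric form, so that
   its diagonal matrices are a Cartan subalgebra and its upper triangular
   matrices a Borel subalgebra. *)
Definition so_form : M := \matrix_(i, j) (i + j == r.*2)%N%:R.

Definition so : {pred M} :=
  fun X => X^T *m so_form + so_form *m X == 0.

Definition so_nplus : {pred M} :=
  fun X => (X \in so) && [forall i : 'I__, forall j : 'I__, (j <= i)%N ==> (X i j == 0)].

(* The basis of the diagonal Cartan subalgebra dual to eps_1, ..., eps_r, with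
   eps_(i+1) the i-th diagonal entry (rows are numbered from 0). *)
Definition cartan_basis (i : nat) : M :=
  delta_mx (inord i) (inord i) - delta_mx (inord (r.*2 - i)) (inord (r.*2 - i)).

(* alpha_i = eps_i - eps_(i+1) for i < r, and alpha_r = eps_r. *)
Definition coroot (i : 'I_r) : M :=
  if i.+1 == r then cartan_basis i *+ 2
  else cartan_basis i - cartan_basis i.+1.

(* Column vectors of height n are a module under rho. Only the values of rho
   on so(2r+1) matter: a linear map on so(2r+1) extends to all matrices. *)
Definition so_module (n : nat) (rho : {linear M -> 'M[F]_n}) : Prop :=
  {in so &, forall X Y,
     rho (X *m Y - Y *m X) = rho X *m rho Y - rho Y *m rho X}.

Definition so_simple (n : nat) (rho : {linear M -> 'M[F]_n}) : Prop :=
  forall U : {vspace 'cV[F]_n},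
    (forall X u, X \in so -> u \in U -> rho X *m u \in U) ->
    U = 0%VS \/ U = fullv.

Definition has_highest_weight (n : nat) (rho : {linear M -> 'M[F]_n})
    (mu : weight r) : Prop :=
  exists2 v : 'cV[F]_n, v != 0 &
    (forall X, X \in so_nplus -> rho X *m v = 0) /\
    (forall i, rho (coroot i) *m v = (mu i)%:~R *: v).

(* rho is (isomorphic to) V_mu *)
Definition is_irrep (mu : weight r) (n : nat) (rho : {linear M -> 'M[F]_n}) :
    Prop :=
  [/\ so_module rho, so_simple rho & has_highest_weight rho mu].

Definition tensor_action (n m : nat) (rho : {linear M -> 'M[F]_n})
    (sigma : {linear M -> 'M[F]_m}) (X : M) : 'M[F]_(n * m) :=
  tensmx (rho X) 1%:M + tensmx 1%:M (sigma X).

(* V_mu is a direct summand of V_lam (x) V_nu: homomorphisms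
   A : V_mu -> V_lam (x) V_nu and B backwards, with B o A = id. *)
Definition tensor_summand (mu lam nu : weight r) : Prop :=
  exists n m p : nat,
  exists rho : {linear M -> 'M[F]_n},
  exists sigma : {linear M -> 'M[F]_m},
  exists tau : {linear M -> 'M[F]_p},
    [/\ is_irrep lam rho, is_irrep nu sigma, is_irrep mu tau &
      exists A : 'M[F]_(n * m, p), exists B : 'M[F]_(p, n * m),
        [/\ forall X, X \in so -> A *m tau X = tensor_action rho sigma X *m A,
            forall X, X \in so -> tau X *m B = B *m tensor_action rho sigma X &
            B *m A = 1%:M]].

(* V_(lam + omega_1 - sum_j l_j alpha_j) is a summand of V_lam (x) V_omega_1 *)
Definition admissible (lam l : 'I_r -> nat) : Prop :=
  tensor_summand
    (fun i => (lam i)%:Z + omega1 i - \sum_j (l j)%:Z * simple_root j i)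
    (dominant_weight lam) (@omega1 r).

End OddOrthogonal.

Definition coloring (r : nat) (l : 'I_r -> nat) (L : nat)
    (c : 'I_L -> 'I_r) : Prop :=
  {homo c : i j / (i <= j)%N} /\ forall a : 'I_r, #|[pred i | c i == a]| = l a.

(* A summand with zero numerator vanishes whatever its denominator is, because
   of the convention 0^-1 = 0; it is thereby omitted. *)
Definition bethe_solution (F : fieldType) (r n L : nat)
    (Lam : 'I_n -> weight r) (z : 'I_n -> F) (c : 'I_L -> 'I_r)
    (t : 'I_L -> F) : Prop :=
  [/\ forall i s, root_pairing (c i) (Lam s) != 0 -> t i != z s,
      forall i j, j != i ->
        root_pairing (c i) (simple_root (c j)) != 0 -> t i != t j &
      forall i,
        - \sum_s (root_pairing (c i) (Lam s))%:~R / (t i - z s)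
        + \sum_(j | j != i)
            (root_pairing (c i) (simple_root (c j)))%:~R / (t i - t j) = 0].

Definition represents (F : fieldType) (r L : nat) (c : 'I_L -> 'I_r)
    (t : 'I_L -> F) (y : 'I_r -> {poly F}) : Prop :=
  forall a, y a = \prod_(j | c j == a) ('X - (t j)%:P).

Notation "x %:F" := (@FracField.tofrac _ x) : ring_scope.

Section Operators.
Variable F : fieldType.

Local Notation K := {fraction {poly F}}.

(* d/dx on F(x), by the quotient rule on a representative fraction;
   ratfun_derivE below shows independence of the representative. *)
Definition ratfun_deriv (f : K) : K :=
  let n := \n_(repr f) in let d := \d_(repr f) in
  (n^`() * d - n * d^`())%:F / (d ^+ 2)%:F.

Definition dln (f : K) : K := ratfun_deriv f / f.

(* A differential operator \sum_k a_k d^k with a_k in F(x) is represented by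
   the polynomial of its coefficients, with 'X standing for d. Composition is
   NOT the commutative product of {poly K}: it is diffop_mul, determined by
   d o (a d^k) = a' d^k + a d^(k+1). *)
Definition diffop := {poly K}.

Definition diff_after (P : diffop) : diffop :=
  map_poly ratfun_deriv P + P * 'X.

Definition diffop_mul (P Q : diffop) : diffop :=
  \sum_(k < size P) P`_k *: iter k diff_after Q.

Definition diff_factor (f : K) : diffop := 'X - (dln f)%:P.

Section Dlambda.
Variables (r : nat) (lam : 'I_r -> nat) (y : 'I_r -> K).

Definition Tfun (i : nat) : K :=
  ('X ^+ at1 0%N lam i)%:F * (if i == 1%N then ('X - 1)%:F else 1).

(* Only the logarithmic derivatives of the y_i and T_i enter. The components y_i
   are rational functions here, which covers the quasi-polynomials x^a p(x)
   with integer exponent a. *)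
Definition Dlambda : diffop :=
  let Y i := at1 1 y i in
  let Tprod i := \prod_(1 <= j < i) Tfun j in
  diffop_mul
    (\big[diffop_mul/1]_(i <- index_iota 1 r.+1)
       diff_factor (Y i.-1 * (\prod_(1 <= j < r) Tfun j ^+ 2) * Tfun r
                    / (Y i * Tprod i)))
    (\big[diffop_mul/1]_(i <- rev (index_iota 1 r.+1))
       diff_factor (Y i * Tprod i / Y i.-1)).

End Dlambda.

Lemma ratfun_derivE (n d : {poly F}) : d != 0 ->
  ratfun_deriv (n%:F / d%:F) = (n^`() * d - n * d^`())%:F / (d ^+ 2)%:F.
Proof.
move=> d0; rewrite /ratfun_deriv; set f := (n%:F / d%:F).
have F0 (p : {poly F}) : (p%:F != 0 :> K) = (p != 0) by rewrite tofrac_eq0.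
have reprE x : (\n_x)%:F = (\pi_K x)%qT * (\d_x)%:F :> K.
  unlock FracField.tofrac; rewrite -[RHS]FracField.pi_mul.
  apply/eqP; rewrite FracField.equivf_def /FracField.mulf.
  rewrite !numden_Ratio ?mulf_neq0 ?oner_neq0 ?denom_ratioP //.
  by rewrite !mulr1 mul1r mulrC.
have := reprE (repr f); rewrite reprK.
move: (denom_ratioP (repr f)); move: (\n_(repr f)) (\d_(repr f)) => m e e0 mE.
have cross : m * d = n * e.
  apply/eqP; rewrite -tofrac_eq !tofracM mE /f.
  by rewrite mulrAC divfK ?F0 // eqxx.
apply/eqP; rewrite eqr_div ?F0 ?expf_neq0 // -!tofracM tofrac_eq; apply/eqP.
have := congr1 (@deriv F) cross; rewrite !derivM => dcross.
apply/eqP; rewrite -subr_eq0; apply/eqP.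
transitivity (e * d * ((m^`() * d + m * d^`()) - (n^`() * e + n * e^`()))
              - (e^`() * d + e * d^`()) * (m * d - n * e)); first by ring.
by rewrite dcross cross !subrr !mulr0 subrr.
Qed.

End Operators.

(* a_lambda^l(i) for 1 <= i <= r, the index i of the tuple being stored as
   i - 1; all subtractions are between naturals and do not truncate when
   l <> r and l <= 2r. *)
Definition exponent (r : nat) (lam : 'I_r -> nat) (l : nat) (i0 : 'I_r) : nat :=
  let la := at1 0%N lam in
  let i := i0.+1 in
  if (l < r)%N then
    if (i <= l)%N then (\sum_(i <= j < l.+1) la j + (l.+1 - i))%N else 0%N
  else
    let k := (r.*2 - l)%N in
    if (i <= k)%N then
      (\sum_(i <= j < k.+1) la j + 2 * \sum_(k.+1 <= j < r) la j + la r
       + (r.*2 - k - i))%N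
    else
      (2 * \sum_(k.+1 <= j < r) la j + la r + (r.*2 - k.*2 - 1))%N.

(* Main.v *)
(** The operator does not change under a reproduction step: if z satisfies
    y_i z' - y_i' z = c T_i y_(i-1) y_(i+1) (with y_(r-1)^2 in place of the last two
    factors when i = r), replacing y_i by z preserves D_lambda, because two adjacent
    first-order factors compose to an operator determined by a Riccati expression. So it
    suffices to join y to the tuple of powers of x by such steps.

    The Bethe equations say that y_i divides F y_i'' - F' y_i', with F = T_i y_(i-1) y_(i+1);
    for separable y_i this is the solvability of the Wronskian equation in polynomials, and
    it survives a reproduction step at a neighbouring index. If l = (1,..,1,0,..,0) with k
    ones, the indices k, ..., 1 turn x - t_i into powers of x. If l = (1,..,1,2,..,2), a
    first pass through k+1, ..., r-1 turns the quadratic y_i into x^(m_i) (x - u_i), the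
    step r turns y_r into x^A, and a second pass through r-1, ..., 1 produces the powers.

    The shape of l comes from representation theory. For a singular vector of weight mu in
    V_lambda (x) V_omega1, seen as a linear map W from the dual of V_omega1 to V_lambda, the
    image of W is stable under the nilpotent subalgebra, hence contains the highest weight
    vector. So mu - lambda satisfies every polynomial relation satisfied by the Cartan
    subalgebra on V_omega1; since V_omega1 is a subquotient of the vector representation,
    the elements h_i of the Cartan subalgebra dual to the eps_i act there with h_i^3 = h_i
    and h_i h_j = 0 for i <> j, and mu - lambda is 0 or +-eps_i. *)
From HB Require Import structures.
Require Import Defs.
From mathcomp Require Import all_boot all_order all_algebra separable.
From mathcomp Require Import complex mxtens reals.
From mathcomp Require Import ring zify.
From mathcomp Require boolp.
From Stdlib Require Import Classical.
Set Implicit Arguments.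
Unset Strict Implicit.
Unset Printing Implicit Defensive.
Import GRing.Theory.
Import Num.Theory.
Local Open Scope ring_scope.

(** * Differential operators over the rational functions *)

Lemma addf_log_deriv (E : fieldType) (f g a b : E) : f != 0 -> g != 0 ->
  (a * g + f * b) / (f * g) = a / f + b / g.
Proof. by move=> f0 g0; field; rewrite f0 g0. Qed.

Section RationalFunctions.
Variable F : fieldType.
Local Notation K := {fraction {poly F}}.
Local Notation D := (@ratfun_deriv F).

Lemma ratfunP (f : K) : exists n d : {poly F}, d != 0 /\ f = n%:F / d%:F.
Proof.
exists \n_(repr f), \d_(repr f); split; first exact: denom_ratioP.
apply: (canRL (mulfK _)); first by rewrite tofrac_eq0 denom_ratioP.
rewrite -{1}[f]reprK; move: (repr f) => x; apply/esym.
unlock FracField.tofrac; rewrite -[RHS]FracField.pi_mul.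
apply/eqP; rewrite FracField.equivf_def /FracField.mulf.
by rewrite !numden_Ratio ?mulf_neq0 ?oner_neq0 ?denom_ratioP // !mulr1 mul1r mulrC.
Qed.

Lemma ratfun_deriv_tofrac (p : {poly F}) : D (p%:F) = (p^`())%:F.
Proof.
have := ratfun_derivE p (oner_neq0 _); rewrite tofrac1 divr1 => ->.
by rewrite expr1n tofrac1 divr1 -[1]/(1%:P) derivC mulr0 subr0 mulr1.
Qed.

Lemma ratfun_deriv_add : {morph D : f g / f + g}.
Proof.
move=> f g; have [n [d [d0 ->]]] := ratfunP f; have [m [e [e0 ->]]] := ratfunP g.
have de0 : d * e != 0 by rewrite mulf_neq0.
rewrite addf_div ?tofrac_eq0 // -!tofracM -tofracD !ratfun_derivE //.
rewrite addf_div ?tofrac_eq0 ?expf_neq0 // -!tofracM -tofracD.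
congr (_%:F / _%:F); rewrite ?derivD ?derivM; ring.
Qed.

Lemma ratfun_deriv_mul f g : D (f * g) = D f * g + f * D g.
Proof.
have [n [d [d0 ->]]] := ratfunP f; have [m [e [e0 ->]]] := ratfunP g.
have de0 : d * e != 0 by rewrite mulf_neq0.
rewrite mulf_div -!tofracM !ratfun_derivE // !mulf_div -!tofracM.
rewrite addf_div ?tofrac_eq0 ?mulf_neq0 ?expf_neq0 // -!tofracM -tofracD.
apply/eqP; rewrite eqr_div ?tofrac_eq0 ?mulf_neq0 ?expf_neq0 //.
by rewrite -!tofracM tofrac_eq; apply/eqP; rewrite ?derivM; ring.
Qed.

Lemma ratfun_deriv0 : D 0 = 0.
Proof. by rewrite -tofrac0 ratfun_deriv_tofrac deriv0. Qed.

Lemma ratfun_deriv1 : D 1 = 0.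
Proof. by rewrite -tofrac1 ratfun_deriv_tofrac -[1]/(1%:P) derivC tofrac0. Qed.

Lemma ratfun_derivN f : D (- f) = - D f.
Proof.
by apply/eqP; rewrite -addr_eq0 -ratfun_deriv_add addNr ratfun_deriv0.
Qed.

Lemma ratfun_derivB f g : D (f - g) = D f - D g.
Proof. by rewrite ratfun_deriv_add ratfun_derivN. Qed.

Lemma dlnM (f g : K) : f != 0 -> g != 0 -> dln (f * g) = dln f + dln g.
Proof.
move=> f0 g0; rewrite /dln ratfun_deriv_mul.
exact: (addf_log_deriv _ _ f0 g0).
Qed.

Lemma dlnV (f : K) : f != 0 -> dln f^-1 = - dln f.
Proof.
move=> f0; apply/eqP; rewrite eq_sym -subr_eq0 -opprD oppr_eq0.
by rewrite -dlnM ?invr_eq0 // mulfV // /dln ratfun_deriv1 mul0r.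
Qed.

Lemma dlnB (f g : K) : f != 0 -> g != 0 -> dln (f / g) = dln f - dln g.
Proof. by move=> f0 g0; rewrite dlnM ?invr_eq0 // dlnV. Qed.

Lemma dln_exp (f : K) n : f != 0 -> dln (f ^+ n) = dln f *+ n.
Proof.
move=> f0; elim: n => [|n IH]; first by rewrite /dln ratfun_deriv1 mul0r.
by rewrite exprS dlnM ?expf_neq0 // IH mulrS.
Qed.

Lemma dln_tofrac (p : {poly F}) : dln (p%:F) = (p^`())%:F / p%:F.
Proof. by rewrite /dln ratfun_deriv_tofrac. Qed.

Local Notation DA := (@diff_after F).

Lemma coef_diff_after (P : {poly K}) k :
  (DA P : {poly K})`_k = D P`_k + (if k is j.+1 then P`_j else 0).
Proof.
rewrite /diff_after coefD coefMX coef_map_id0; last exact: ratfun_deriv0.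
by case: k.
Qed.

Lemma diff_after_add : {morph DA : P Q / P + Q}.
Proof.
move=> P Q; apply/polyP => -[|k]; rewrite coefD !coef_diff_after !coefD.
  by rewrite ratfun_deriv_add !addr0.
by rewrite ratfun_deriv_add addrACA.
Qed.

Lemma diff_after_scale a P : DA (a *: P) = D a *: P + a *: DA P.
Proof.
apply/polyP => k; rewrite !(coefD, coefZ, coef_diff_after) ratfun_deriv_mul.
by case: k => [|k]; rewrite ?coefZ ?mulrDr ?mulr0 ?addr0 ?addrA.
Qed.

Lemma diff_after0 : DA 0 = 0.
Proof.
apply/polyP => k; rewrite coef_diff_after !coef0 ratfun_deriv0.
by case: k => [|k]; rewrite ?coef0 addr0.
Qed.

Lemma diff_after_sum (I : Type) (r : seq I) (P : pred I) (E : I -> diffop F) :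
  DA (\sum_(i <- r | P i) E i) = \sum_(i <- r | P i) DA (E i).
Proof. by apply: big_morph; [exact: diff_after_add | exact: diff_after0]. Qed.

(** Left composition with d - b as a map on operators, so that an iterated product of first-order
    factors becomes a [foldr] of such maps. *)
Definition first_order (b : K) (Q : diffop F) : diffop F := DA Q - b *: Q.

(** A composite of two first-order factors thus depends only on a + b and a b - D b; these two
    functions are what a change of adjacent factors must preserve. *)
Lemma first_orderK a b Q : first_order a (first_order b Q) =
  DA (DA Q) - (a + b) *: DA Q + (a * b - D b) *: Q.
Proof.
rewrite /first_order; have -> : DA (DA Q - b *: Q) = DA (DA Q) - (D b *: Q + b *: DA Q).
  rewrite -scaleNr diff_after_add diff_after_scale ratfun_derivN !scaleNr.
  by rewrite opprD.
rewrite scalerBr scalerBl scalerDl scalerA !opprD !opprK !addrA.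
by rewrite [LHS](ACl (1*4*3*5*2))%AC.
Qed.

Lemma diffop_mul_widen n (P : {poly K}) (Q : diffop F) : (size P <= n)%N ->
  diffop_mul P Q = \sum_(k < n) P`_k *: iter k DA Q.
Proof.
move=> le_n; rewrite /diffop_mul (big_ord_widen n (fun k => P`_k *: iter k DA Q)) //.
rewrite big_mkcond; apply: eq_bigr => i _; case: ltnP => // le_i.
by rewrite nth_default // scale0r.
Qed.

Lemma diffop_mul_add (P1 P2 : {poly K}) (Q : diffop F) :
  diffop_mul (P1 + P2) Q = diffop_mul P1 Q + diffop_mul P2 Q.
Proof.
pose n := maxn (size P1) (size P2).
rewrite (@diffop_mul_widen n (P1 + P2)) ?size_polyD //.
rewrite (@diffop_mul_widen n P1) ?leq_maxl // (@diffop_mul_widen n P2) ?leq_maxr //.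
by rewrite -big_split; apply: eq_bigr => i _; rewrite coefD scalerDl.
Qed.

Lemma diffop_mul_scale a (P : {poly K}) (Q : diffop F) : diffop_mul (a *: P) Q = a *: diffop_mul P Q.
Proof.
rewrite (@diffop_mul_widen (size P)) ?size_scale_leq // scaler_sumr.
by apply: eq_bigr => i _; rewrite coefZ scalerA.
Qed.

(** Associativity with d as leftmost factor. The Leibniz rule splits both sides into terms with a
    differentiated coefficient of P and terms with one more d applied to Q. *)
Lemma diffop_mul_diff_after (P : {poly K}) (Q : diffop F) :
  diffop_mul (DA P) Q = DA (diffop_mul P Q).
Proof.
have szDA : (size (DA P) <= (size P).+1)%N.
  apply/leq_sizeP => -[|k] // lek; rewrite coef_diff_after.
  by rewrite !nth_default // ?ratfun_deriv0 ?addr0 // ltnW.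
rewrite (@diffop_mul_widen (size P).+1) // /diffop_mul diff_after_sum.
under [RHS]eq_bigr do rewrite diff_after_scale.
under [LHS]eq_bigr do rewrite coef_diff_after scalerDl.
rewrite !big_split /=; congr (_ + _).
  by rewrite big_ord_recr /= nth_default // ratfun_deriv0 scale0r addr0.
by rewrite big_ord_recl scale0r add0r.
Qed.

Lemma diffop_mul_factor b P Q :
  diffop_mul (first_order b P) Q = first_order b (diffop_mul P Q).
Proof.
by rewrite /first_order -scaleNr diffop_mul_add diffop_mul_scale
           diffop_mul_diff_after scaleNr.
Qed.

Lemma diffop_mul1 (Q : diffop F) : diffop_mul 1 Q = Q.
Proof. by rewrite /diffop_mul size_poly1 big_ord1 /= coefC /= scale1r. Qed.

Lemma diff_factorE f Q : diffop_mul (diff_factor f) Q = first_order (dln f) Q.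
Proof.
rewrite /diff_factor /diffop_mul size_XsubC !big_ord_recl big_ord0 addr0 /=.
by rewrite !coefB !coefX !coefC /= sub0r subr0 scale1r scaleNr addrC.
Qed.

Lemma diff_factors_foldr (s : seq nat) (f : nat -> K) Q :
  diffop_mul (\big[@diffop_mul F/1]_(i <- s) diff_factor (f i)) Q =
  foldr (fun i => first_order (dln (f i))) Q s.
Proof.
elim: s => [|i s IH]; first by rewrite big_nil diffop_mul1.
by rewrite big_cons /= diff_factorE diffop_mul_factor IH.
Qed.

Lemma big_diff_factors_foldr (s : seq nat) (f : nat -> K) :
  \big[@diffop_mul F/1]_(i <- s) diff_factor (f i) =
  foldr (fun i => first_order (dln (f i))) 1 s.
Proof.
elim: s => [|i s IH]; first by rewrite big_nil.
by rewrite big_cons /= diff_factorE IH.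
Qed.

End RationalFunctions.

(** The indexed letters stand for derivatives, and the second Wronskian hypothesis is the derivative
    of the first. Both y and z solve g u'' - g' u' + q u = 0 for one and the same q, and the two
    sides are q / g. *)
Lemma riccati_wronskian (E : fieldType) (y y1 y2 z z1 z2 g g1 c : E) :
  y != 0 -> z != 0 -> g != 0 ->
  y * z1 - y1 * z = c * g -> y * z2 - y2 * z = c * g1 ->
  g1 / g * (y1 / y) - y2 / y = g1 / g * (z1 / z) - z2 / z.
Proof.
move=> y0 z0 g0 w w'; apply/eqP; rewrite -subr_eq0; apply/eqP.
have -> : g1 / g * (y1 / y) - y2 / y - (g1 / g * (z1 / z) - z2 / z) =
  ((y * z2 - y2 * z) - g1 / g * (y * z1 - y1 * z)) / (y * z).
  by field; rewrite y0 z0 g0.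
by rewrite w w'; field; rewrite y0 z0 g0.
Qed.

Lemma addrB_log (V : zmodType) (u v w t : V) : w + u - (v + t) = u - (v + t - w).
Proof. by rewrite opprB addrA [u + w]addrC. Qed.

(** Shifting eta by alpha changes the Riccati expression by beta alpha - da, which does not involve
    eta. *)
Lemma shifted_riccati (E : comPzRingType) (alpha beta eta eta' d d' da : E) :
  (beta - alpha) * eta - eta * eta - d =
  (beta - alpha) * eta' - eta' * eta' - d' ->
  (beta - eta) * (eta + alpha) - (d + da) =
  (beta - eta') * (eta' + alpha) - (d' + da).
Proof.
have aux x dx : (beta - x) * (x + alpha) - (dx + da) =
    ((beta - alpha) * x - x * x - dx) + (beta * alpha - da) by ring.
by move=> e; rewrite !aux e.
Qed.

Lemma telescope_log (V : zmodType) (x p n t s : V) :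
  t + p + n = n + (s + t) - (s - p).
Proof. by rewrite opprB !addrA [LHS](ACl (3*1*2))%AC [RHS](ACl (1*3*4*(2*5)))%AC /= subrr addr0. Qed.

Lemma telescope_log2 (V : zmodType) (x p s : V) :
  x + p *+ 2 = s *+ 2 + x - (s - p) - (s - p).
Proof.
rewrite !opprB !mulr2n !addrA.
by rewrite [RHS](ACl (3*4*6*(1*5)*(2*7)))%AC /= !subrr !addr0.
Qed.

Lemma addr_cancel_pair (V : zmodType) (x x' a b : V) :
  x + a + (b - x) = x' + a + (b - x').
Proof.
by rewrite !addrA [LHS](ACl (2*3*(1*4)))%AC [RHS](ACl (2*3*(1*4)))%AC /= !subrr.
Qed.

(** * Symmetric products of first-order factors *)

Section Factorization.
Variables (F : fieldType).
Local Notation K := {fraction {poly F}}.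
Local Notation D := (@ratfun_deriv F).
Local Notation DO := (@first_order F).

Lemma foldr_eq_in (f h : nat -> K) s Q : {in s, f =1 h} ->
  foldr (fun i => DO (f i)) Q s = foldr (fun i => DO (h i)) Q s.
Proof.
elim: s => [|i s IH] //= eq_fh; rewrite eq_fh ?mem_head // IH // => j js.
by apply: eq_fh; rewrite in_cons js orbT.
Qed.

Lemma first_order_pair (a b a' b' : K) :
  a + b = a' + b' -> a * b - D b = a' * b' - D b' ->
  forall Q, DO a (DO b Q) = DO a' (DO b' Q).
Proof. by move=> e1 e2 Q; rewrite !first_orderK e1 e2. Qed.

(* By diff_factorE, D_lambda is of this form, with b i = dln g_i for the
   functions g_i in the right-hand factors and p = dln (T_1^2 .. T_(r-1)^2 T_r). *)
Definition twosided (p : K) (b : nat -> K) (r : nat) : diffop F :=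
  foldr (fun i => DO (p - b i))
    (foldr (fun i => DO (b i)) 1 (rev (index_iota 1 r.+1))) (index_iota 1 r.+1).

Lemma index_iota_split n k m : (n <= k <= m)%N ->
  index_iota n m = index_iota n k ++ index_iota k m.
Proof.
move=> /andP[nk km]; rewrite /index_iota.
have -> : (m - n = (k - n) + (m - k))%N by lia.
by rewrite iotaD; congr (_ ++ iota _ _); lia.
Qed.

(** The index k occurs in the right half through the pair b_(k+1), b_k and, mirrored, in the left
    half through p - b_k, p - b_(k+1). The two hypotheses on b_k and b_(k+1) fix the composites of
    both pairs. *)
Lemma twosided_swap p b b' r k : (0 < k < r)%N ->
  (forall i, i != k -> i != k.+1 -> b i = b' i) ->
  b k + b k.+1 = b' k + b' k.+1 ->
  b k.+1 * b k - D (b k) = b' k.+1 * b' k - D (b' k) ->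
  twosided p b r = twosided p b' r.
Proof.
move=> /andP[k0 kr] eqb e1 e2.
have e3 : D (b k) + D (b k.+1) = D (b' k) + D (b' k.+1).
  by rewrite -!ratfun_deriv_add e1.
have eqL Q : DO (b k.+1) (DO (b k) Q) = DO (b' k.+1) (DO (b' k) Q).
  by apply: first_order_pair => //; rewrite addrC e1 addrC.
have eqR Q : DO (p - b k) (DO (p - b k.+1) Q) =
             DO (p - b' k) (DO (p - b' k.+1) Q).
  (* The invariants of the mirrored pair are expressed through those of the original pair and the
     derivative of its sum. *)
  have aux (u v : K) : (p - u) * (p - v) - D (p - v) =
     p * p - p * (u + v) + (v * u - D u) + (D u + D v) - D p.
    by rewrite ratfun_derivB; move: (D p) (D u) (D v) => dp du dv; ring.
  apply: first_order_pair; last by rewrite !aux e1 e2 e3.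
  by rewrite addrACA -opprD e1 [RHS]addrACA -opprD.
rewrite /twosided (@index_iota_split 1 k r.+1) ?(@index_iota_split k k.+2 r.+1); try lia.
have -> : index_iota k k.+2 = [:: k; k.+1].
  by rewrite /index_iota (_ : (k.+2 - k)%N = 2) //; lia.
have outl j : j \in index_iota 1 k -> (j != k) && (j != k.+1).
  by rewrite mem_index_iota => /andP[_ jk]; lia.
have outr j : j \in index_iota k.+2 r.+1 -> (j != k) && (j != k.+1).
  by rewrite mem_index_iota => /andP[jk _]; lia.
rewrite !rev_cat !foldr_cat /= eqL eqR.
have eqs (s : seq nat) (f h : K -> K) Q : (forall x, f x = h x) ->
    (forall j, j \in s -> (j != k) && (j != k.+1)) ->
    foldr (fun i => DO (f (b i))) Q s = foldr (fun i => DO (h (b' i))) Q s.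
  move=> fh js; apply: (@foldr_eq_in (f \o b) (h \o b')) => j /js/andP[j1 j2] /=.
  by rewrite eqb.
rewrite (eqs (rev (index_iota 1 k)) id id) //; last first.
  by move=> j; rewrite mem_rev; exact: outl.
rewrite (eqs (rev (index_iota k.+2 r.+1)) id id) //; last first.
  by move=> j; rewrite mem_rev; exact: outr.
rewrite (eqs (index_iota k.+2 r.+1) (fun x => p - x) (fun x => p - x)) //.
by rewrite (eqs (index_iota 1 k) (fun x => p - x) (fun x => p - x)).
Qed.

(** The two innermost factors, with p - b_r and b_r, are adjacent and have sum p whatever b_r is, so
    one condition suffices. *)
Lemma twosided_swap_last p b b' r : (0 < r)%N ->
  (forall i, (i < r)%N -> b i = b' i) ->
  p * b r - b r * b r - D (b r) = p * b' r - b' r * b' r - D (b' r) ->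
  twosided p b r = twosided p b' r.
Proof.
move=> r0 eqb e1.
have eqM Q : DO (p - b r) (DO (b r) Q) = DO (p - b' r) (DO (b' r) Q).
  by apply: first_order_pair; rewrite ?subrK // !mulrBl.
rewrite /twosided (@index_iota_split 1 r r.+1) ?r0 ?leqnSn //.
have -> : index_iota r r.+1 = [:: r] by rewrite /index_iota subSnn.
have outl j : j \in index_iota 1 r -> (j < r)%N.
  by rewrite mem_index_iota => /andP[_ jk].
rewrite !rev_cat !foldr_cat /= eqM.
rewrite (@foldr_eq_in b b'); last by move=> j; rewrite mem_rev => /outl /eqb.
by rewrite (@foldr_eq_in (fun i => p - b i) (fun i => p - b' i)) // => j /outl /eqb ->.
Qed.

End Factorization.

(** * Invariance of the operator under a reproduction step *)

Section Invariance.
Variables (F : fieldType) (r : nat) (lam : 'I_r -> nat).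
Local Notation K := {fraction {poly F}}.
Local Notation D := (@ratfun_deriv F).
Local Notation DO := (@first_order F).
Local Notation T := (Tfun F lam).
Hypothesis r2 : (2 <= r)%N.

Let Tprod i : K := \prod_(1 <= j < i) T j.
Let Ttot : K := \prod_(1 <= j < r) T j ^+ 2 * T r.
Let la := at1 0%N lam.

Lemma Tfun_neq0 i : T i != 0.
Proof.
rewrite /Tfun mulf_neq0 ?tofrac_eq0 ?expf_neq0 ?polyX_eq0 //.
by case: ifP; rewrite ?oner_neq0 // tofrac_eq0 -[1]/(1%:P) polyXsubC_eq0.
Qed.

Lemma Tprod_neq0 i : Tprod i != 0.
Proof. by rewrite prodf_seq_neq0; apply/allP => j _; rewrite Tfun_neq0 implybT. Qed.

Definition ratfun_tuple (Y : nat -> {poly F}) (i : 'I_r) : K := (Y i.+1)%:F.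

Definition log_factor (Y : nat -> {poly F}) (i : nat) : K :=
  dln (at1 1 (ratfun_tuple Y) i) + dln (Tprod i) - dln (at1 1 (ratfun_tuple Y) i.-1).

Lemma at1_ratfun_tuple Y i : (0 < i <= r)%N -> at1 1 (ratfun_tuple Y) i = (Y i)%:F.
Proof. by case: i => // i ir; rewrite /at1 insubT. Qed.

Lemma at1_neq0 Y i : (forall j, Y j != 0) -> at1 1 (ratfun_tuple Y) i != 0.
Proof.
case: i => [|i] Y0; rewrite /at1 ?oner_neq0 //.
by case: insubP => [j _ _|_] /=; rewrite ?oner_neq0 // tofrac_eq0.
Qed.

Lemma Dlambda_twosided Y : (forall j, Y j != 0) ->
  Dlambda lam (ratfun_tuple Y) = twosided (dln Ttot) (log_factor Y) r.
Proof.
move=> Y0; have a0 i := at1_neq0 i Y0.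
have Ttot0 : Ttot != 0.
  by rewrite mulf_neq0 ?Tfun_neq0 //; rewrite prodf_seq_neq0; apply/allP => j _; rewrite expf_neq0 ?Tfun_neq0 ?implybT.
rewrite /Dlambda diff_factors_foldr big_diff_factors_foldr /twosided.
have e1 i : dln (at1 1 (ratfun_tuple Y) i * Tprod i / at1 1 (ratfun_tuple Y) i.-1) =
    log_factor Y i.
  have H := mulf_neq0 (a0 i) (Tprod_neq0 i).
  rewrite (dlnB H (a0 _)) (dlnM (a0 _) (Tprod_neq0 _)); reflexivity.
have e2 i : dln (at1 1 (ratfun_tuple Y) i.-1 * \prod_(1 <= j < r) T j ^+ 2 * T r /
      (at1 1 (ratfun_tuple Y) i * Tprod i)) = dln Ttot - log_factor Y i.
  rewrite -[_ * _ * T r]mulrA -/Ttot.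
  rewrite (dlnB (mulf_neq0 (a0 _) Ttot0) (mulf_neq0 (a0 _) (Tprod_neq0 _))).
  rewrite (dlnM (a0 _) Ttot0) (dlnM (a0 _) (Tprod_neq0 _)) /log_factor.
  exact: addrB_log.
have E1 s : foldr (fun i => DO (dln (at1 1 (ratfun_tuple Y) i * Tprod i /
      at1 1 (ratfun_tuple Y) i.-1))) 1 s = foldr (fun i => DO (log_factor Y i)) 1 s.
  by elim: s => //= i s ->; rewrite e1.
have E2 Q s : foldr (fun i => DO (dln (at1 1 (ratfun_tuple Y) i.-1 *
      \prod_(1 <= j < r) T j ^+ 2 * T r / (at1 1 (ratfun_tuple Y) i * Tprod i)))) Q s =
    foldr (fun i => DO (dln Ttot - log_factor Y i)) Q s.
  by elim: s => //= i s ->; rewrite e2.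
rewrite E2; congr foldr; exact: E1.
Qed.

Lemma dln1 : dln (1 : K) = 0.
Proof. by rewrite /dln ratfun_deriv1 mul0r. Qed.

Lemma dln_Tfun k : (0 < k)%N ->
  dln (T k) = dln ('X ^+ la k)%:F + (if k == 1%N then dln ('X - 1 : {poly F})%:F else 0).
Proof.
have X0 : ('X ^+ la k : {poly F})%:F != 0 :> K.
  by rewrite tofrac_eq0 expf_neq0 ?polyX_eq0.
have X1 : ('X - 1 : {poly F})%:F != 0 :> K.
  by rewrite tofrac_eq0 -[1]/(1%:P) polyXsubC_eq0.
move=> k0; rewrite /Tfun -/la; case: ifP => _; first exact: (dlnM X0 X1).
by rewrite mulr1 addr0.
Qed.

(* Y 0 = X - 1 absorbs the factor x - 1 of T_1, so that T_k may be taken to be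
   x^lambda_k for all k. *)
Definition neighbours (Y : nat -> {poly F}) (k : nat) : {poly F} :=
  'X ^+ la k * (if (k < r)%N then Y k.-1 * Y k.+1 else Y k.-1 ^+ 2).

(** Since (ln' u)^2 + (ln' u)' = u''/u, this is [riccati_wronskian] written with logarithmic
    derivatives. *)
Lemma riccati_tofrac (y z g : {poly F}) c : y != 0 -> z != 0 -> g != 0 ->
  y * z^`() - y^`() * z = c *: g ->
  dln g%:F * dln y%:F - dln y%:F * dln y%:F - D (dln y%:F) =
  dln g%:F * dln z%:F - dln z%:F * dln z%:F - D (dln z%:F).
Proof.
move=> y0 z0 g0 w.
have w' : y * z^`()^`() - y^`()^`() * z = c *: g^`().
  by rewrite -derivZ -w derivB !derivM; ring.
have D_dln (u : {poly F}) : u != 0 ->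
    dln u%:F * dln u%:F + D (dln u%:F) = (u^`()^`())%:F / u%:F.
  move=> u0; rewrite dln_tofrac ratfun_derivE // mulf_div -!tofracM -[u * u]expr2.
  rewrite -mulrDl -tofracD addrC subrK; apply/eqP.
  rewrite eqr_div ?tofrac_eq0 ?expf_neq0 // -!tofracM tofrac_eq.
  by apply/eqP; ring.
rewrite -!addrA -!opprD !D_dln // !dln_tofrac.
apply: (@riccati_wronskian _ _ _ _ _ _ _ _ _ (c%:P)%:F); rewrite ?tofrac_eq0 //.
  by rewrite -!tofracM -tofracB w mul_polyC.
by rewrite -!tofracM -tofracB w' mul_polyC.
Qed.


(** With a = ln' y_k, the factor k has logarithmic term a + alpha and, for k < r, the factor k + 1
    has beta - a, where beta - alpha is ln' of [neighbours]. At k = r the innermost pair leads to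
    ln' Ttot - 2 alpha instead, which is why y_(r-1) is squared in [neighbours]. *)
Lemma Dlambda_swap (Y Y' : nat -> {poly F}) k c : (0 < k <= r)%N ->
  Y 0%N = 'X - 1 -> (forall j, Y j != 0) -> (forall j, Y' j != 0) ->
  (forall j, j != k -> Y' j = Y j) ->
  Y k * (Y' k)^`() - (Y k)^`() * Y' k = c *: neighbours Y k ->
  Dlambda lam (ratfun_tuple Y) = Dlambda lam (ratfun_tuple Y').
Proof.
move=> /andP[k0 kr] Y00 Yn0 Yn0' eqY w.
have n0 : neighbours Y k != 0.
  by rewrite mulf_neq0 ?expf_neq0 ?polyX_eq0 //; case: ifP; rewrite ?mulf_neq0 ?expf_neq0.
have := riccati_tofrac (Yn0 k) (Yn0' k) n0 w.
rewrite !Dlambda_twosided //.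
have eqa j : j != k -> at1 1 (ratfun_tuple Y') j = at1 1 (ratfun_tuple Y) j.
  case: j => // j jk; rewrite /at1; case: insubP => //= i _ ij.
  by rewrite /ratfun_tuple eqY //; rewrite -ij in jk.
have eqk : at1 1 (ratfun_tuple Y) k = (Y k)%:F by rewrite at1_ratfun_tuple ?k0.
have eqk' : at1 1 (ratfun_tuple Y') k = (Y' k)%:F by rewrite at1_ratfun_tuple ?k0.
(* For k = 1 the factor x - 1 belongs to T_1 on the left, where component 0 is 1, and to Y 0 on the
   right. *)
have ln_prev : dln (T k) + dln (at1 1 (ratfun_tuple Y) k.-1) =
    dln ('X ^+ la k)%:F + dln (Y k.-1)%:F.
  rewrite dln_Tfun // -addrA; congr (_ + _).
  case: eqP => [-> /=|k1]; first by rewrite Y00 dln1 addr0.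
  by rewrite add0r at1_ratfun_tuple //; lia.
have Yn0F j : (Y j)%:F != 0 :> K by rewrite tofrac_eq0.
have X0 : ('X ^+ la k : {poly F})%:F != 0 :> K.
  by rewrite tofrac_eq0 expf_neq0 ?polyX_eq0.
have eqlf i : i != k -> i != k.+1 -> log_factor Y i = log_factor Y' i.
  by move=> ik ik1; rewrite /log_factor !eqa //; lia.
pose alpha := dln (Tprod k) - dln (at1 1 (ratfun_tuple Y) k.-1).
have lf_k : log_factor Y k = dln (Y k)%:F + alpha by rewrite /log_factor eqk addrA.
have lf_k' : log_factor Y' k = dln (Y' k)%:F + alpha.
  by rewrite /log_factor eqk' addrA eqa //; lia.
rewrite /neighbours; case: (ltnP k r) => [ltkr|gekr] ric.
  pose beta := dln (Y k.+1)%:F + dln (Tprod k.+1).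
  have lf_k1 : log_factor Y k.+1 = beta - dln (Y k)%:F.
    by rewrite /log_factor succnK eqk at1_ratfun_tuple.
  have lf_k1' : log_factor Y' k.+1 = beta - dln (Y' k)%:F.
    by rewrite /log_factor succnK eqk' eqa ?at1_ratfun_tuple //; lia.
  have gam : dln ('X ^+ la k * (Y k.-1 * Y k.+1))%:F = beta - alpha.
    rewrite 2!tofracM (dlnM X0 (mulf_neq0 (Yn0F _) (Yn0F _))).
    rewrite (dlnM (Yn0F _) (Yn0F _)) /beta /alpha.
    have -> : Tprod k.+1 = Tprod k * T k by rewrite /Tprod big_nat_recr.
    rewrite (dlnM (Tprod_neq0 _) (Tfun_neq0 _)).
    by rewrite addrA -ln_prev; apply: telescope_log.
  rewrite gam in ric.
  apply: (@twosided_swap _ _ _ _ _ k); rewrite ?k0 ?ltkr //.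
    by rewrite lf_k lf_k' lf_k1 lf_k1'; apply: addr_cancel_pair.
  rewrite lf_k lf_k' lf_k1 lf_k1' !ratfun_deriv_add.
  exact: shifted_riccati ric.
have ekr : k = r by lia.
have prevE : at1 1 (ratfun_tuple Y) k.-1 = (Y k.-1)%:F by rewrite at1_ratfun_tuple //; lia.
have gam : dln ('X ^+ la k * Y k.-1 ^+ 2)%:F = dln Ttot - alpha - alpha.
  have TtotE : Ttot = Tprod k ^+ 2 * T k by rewrite ekr /Ttot prodrXl.
  rewrite tofracM [(Y k.-1 ^+ 2)%:F]tofracXn (dlnM X0 (expf_neq0 2 (Yn0F _))).
  rewrite (dln_exp 2 (Yn0F _)) TtotE.
  rewrite (dlnM (expf_neq0 2 (Tprod_neq0 _)) (Tfun_neq0 _)).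
  rewrite (dln_exp 2 (Tprod_neq0 _)) /alpha.
  rewrite dln_Tfun // (_ : (k == 1%N) = false) ?addr0; last by lia.
  by rewrite prevE; apply: telescope_log2.
have p_alpha (x dx : K) : dln Ttot * (x + alpha) - (x + alpha) * (x + alpha) -
      (dx + D alpha) =
    (dln Ttot - alpha - alpha) * x - x * x - dx +
    (dln Ttot * alpha - alpha * alpha - D alpha).
  by move: (dln Ttot) (D alpha) (alpha) => u v w0; ring.
(* Although k = r, the types of [lam] and of the tuples depend on r; the fresh n isolates the one
   occurrence to be replaced. *)
suff sw n : n = k -> twosided (dln Ttot) (log_factor Y) n =
  twosided (dln Ttot) (log_factor Y') n by apply: sw.
move=> ->; apply: twosided_swap_last => //.
  by move=> i ik; apply: eqlf; lia.
have D_alpha x : D (x + alpha) = D x + D alpha := ratfun_deriv_add x alpha.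
by rewrite lf_k lf_k' !D_alpha !p_alpha -gam ric.
Qed.

End Invariance.

(** * Wronskians and reproduction *)

Section Wronskian.
Variable F : numFieldType.
Implicit Types (y z f d u w : {poly F}).

Definition wronskian y z := y * z^`() - y^`() * z.

Lemma antiderivative f : exists g, g^`() = f.
Proof.
exists (\poly_(i < (size f).+1) (f`_i.-1 / i%:R)); apply/polyP => i.
rewrite coef_deriv coef_poly ltnS; case: ltnP => [_|/leq_sizeP->] //=; last by rewrite mul0rn.
by rewrite -[_ / _ *+ _]mulr_natr mulfVK // pnatr_eq0.
Qed.

(** For d = y separable this is the Bethe equation f'/f = y''/y' at the roots of y, with
    denominators cleared. A separate modulus d allows the test at a single root. *)
Definition compat d y f := d %| f * y^`()^`() - f^`() * y^`().

(** The new expression times u is the old one times z modulo the Wronskian of u and z, and u cancels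
    because it is prime to d. A reproduction step at a neighbouring index thus preserves
    compatibility. *)
Lemma compat_neighbour d y u z w : coprimep d u -> d %| wronskian u z ->
  compat d y (u * w) -> compat d y (z * w).
Proof.
move=> cop duz; rewrite /compat => duw; rewrite -(Gauss_dvdpr _ cop).
have -> : u * (z * w * y^`()^`() - (z * w)^`() * y^`()) =
    z * (u * w * y^`()^`() - (u * w)^`() * y^`()) - wronskian u z * (w * y^`()).
  by rewrite /wronskian !derivM; ring.
by apply: dvdp_sub; [exact: dvdp_mull | exact: dvdp_mulr].
Qed.

(** Substituting the Wronskian for f, the terms of f z'' - f' z' without a factor z cancel. *)
Lemma wronskian_compat y z f c : c != 0 -> wronskian y z = c *: f -> compat z z f.
Proof.
move=> c0 w; rewrite /compat -(dvdpZr _ _ c0) scalerBr !scalerAl -derivZ -w.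
rewrite /wronskian derivB !derivM.
have -> : (y * z^`() - y^`() * z) * z^`()^`() -
   (y^`() * z^`() + y * z^`()^`() - (y^`()^`() * z + y^`() * z^`())) * z^`() =
   z * (y^`()^`() * z^`() - y^`() * z^`()^`()) by ring.
exact: dvdp_mulr.
Qed.

(** The Bezout relation gives z0 whose Wronskian with y is f + y q. Differentiation and
    compatibility force y to divide q, say q = g y; subtracting y times an antiderivative of g from
    z0 removes the error y^2 g. *)
Lemma partner_exists y f : coprimep y y^`() -> compat y y f ->
  exists z, wronskian y z = f.
Proof.
move=> cop dvd_f.
have /Bezout_eq1_coprimepP[[a b] /= ab1] := cop.
pose z0 := - (f * b); pose q := z0^`() - f * a.
have z0E : wronskian y z0 - f = y * q.
  have fE : f = f * (a * y + b * y^`()) by rewrite ab1 mulr1.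
  rewrite {1}fE /wronskian /q /z0; ring.
have /dvdpP[g gE] : y %| q.
  have cop2 : coprimep y (y^`() * y^`()) by rewrite coprimepMr cop.
  rewrite -(Gauss_dvdpr _ cop2).
  have := congr1 (@deriv F) z0E; rewrite /wronskian derivB !derivM derivB !derivM => dE.
  have -> : y^`() * y^`() * q = f * y^`()^`() - f^`() * y^`()
     + y * (z0^`()^`() * y^`() - y^`()^`() * z0^`() - q^`() * y^`() + y^`()^`() * q).
    apply/eqP; rewrite -subr_eq0; apply/eqP.
    transitivity (y^`() * (y^`() * q + y * q^`() - (y^`() * z0^`() + y * z0^`()^`() - (y^`()^`() * z0 + y^`() * z0^`()) - f^`()))
     + y^`()^`() * ((y * z0^`() - y^`() * z0 - f) - y * q)); first by ring.
    by rewrite dE z0E !subrr !mulr0 addr0.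
  by rewrite dvdp_add // dvdp_mulr.
have [s sE] := antiderivative g.
exists (z0 - y * s); rewrite /wronskian derivB derivM sE.
transitivity (wronskian y z0 - y * y * g); first by rewrite /wronskian; ring.
have -> : y * y * g = y * q by rewrite gE; ring.
by rewrite -z0E opprB addrC subrK.
Qed.

Lemma size_deriv_leq (p : {poly F}) : (size p^`() <= (size p).-1)%N.
Proof.
by apply/leq_sizeP => j pj; rewrite coef_deriv nth_default ?mul0rn // (leq_trans (leqSpred _)).
Qed.

Lemma coefM_top (p q : {poly F}) a b : (size p <= a.+1)%N -> (size q <= b.+1)%N ->
  (p * q)`_(a + b) = p`_a * q`_b.
Proof.
move=> pa qb; rewrite coefM (bigD1 (inord a)) //= inordK ?ltnS ?leq_addr //.
rewrite addKn big1 ?addr0 // => i; rewrite -val_eqE /= inordK ?ltnS ?leq_addr // => ia.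
case: (ltngtP i a) ia => // [ia|ai] _.
  by rewrite [q`_ _]nth_default ?mulr0 // (leq_trans qb) //; lia.
by rewrite [p`_ _]nth_default ?mul0r // (leq_trans pa).
Qed.

Lemma coef_wronskian_top y z a b : (size y <= a.+2)%N -> (size z <= b.+1)%N ->
  (wronskian y z)`_(a + b) = (b%:R - a.+1%:R) * (y`_a.+1 * z`_b).
Proof.
move=> ya zb; have -> : (wronskian y z)`_(a + b) = (y * z^`())`_(a + b) - (y^`() * z)`_(a + b).
  by rewrite coefB.
have -> : (y^`() * z)`_(a + b) = a.+1%:R * (y`_a.+1 * z`_b).
  rewrite coefM_top // ?coef_deriv ?mulrA ?mulr_natl //.
  by apply: leq_trans (size_deriv_leq _) _; lia.
have -> : (y * z^`())`_(a + b) = b%:R * (y`_a.+1 * z`_b).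
  case: b zb => [|b] zb.
    have -> : z^`() = 0 by rewrite (size1_polyC zb) derivC.
    by rewrite mulr0 coef0 mul0r.
  rewrite addnS -addSn coefM_top // ?coef_deriv; first by rewrite mulr_natl mulrnAr.
  by apply: leq_trans (size_deriv_leq _) _; lia.
by rewrite mulrBl.
Qed.

(** The leading terms of y z' and y' z cancel only if z is quadratic too, and then the Wronskian has
    degree at most 2. Otherwise its degree is deg z + 1. *)
Lemma size_quadratic_partner y z : size y = 3 -> (4 <= size (wronskian y z))%N ->
  size z = (size (wronskian y z)).-1 /\ size z != 3.
Proof.
move=> y3 w4; have z0 : z != 0.
  by apply: contraTneq w4 => ->; rewrite /wronskian deriv0 !mulr0 subrr size_poly0.
have zS : size z = (size z).-1.+1 by rewrite prednK // size_poly_gt0.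
set b := (size z).-1 in zS.
have y3' : (size y <= 3)%N by rewrite y3.
have ub : (size (wronskian y z) <= b.+2)%N.
  apply/leq_sizeP => j bj.
  have zj : (size z <= j.-1.+1)%N by rewrite zS; lia.
  have -> : j = (1 + j.-1)%N by lia.
  rewrite (coef_wronskian_top y3' zj) [z`_ _]nth_default ?mulr0 //.
  by rewrite zS; lia.
have top := coef_wronskian_top y3' (leq_trans (eq_leq zS) (leqnn _)).
have [b2|b2] := eqVneq b 2.
  exfalso; have : (size (wronskian y z) <= 3)%N.
    apply/leq_sizeP => j; rewrite leq_eqVlt => /orP[/eqP<-|lt3j].
      by rewrite b2 in top; rewrite top subrr mul0r.
    by apply: (leq_sizeP _ _ ub); rewrite b2.
  by rewrite leqNgt w4.
split; last by rewrite zS.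
have : (wronskian y z)`_(1 + b) != 0.
  rewrite top; apply: mulf_neq0; first by rewrite subr_eq0 eqr_nat.
  apply: mulf_neq0; first by have := lead_coef_eq0 y; rewrite lead_coefE y3 /= => ->; rewrite -size_poly_eq0 y3.
  by have := lead_coef_eq0 z; rewrite lead_coefE -/b => ->.
move=> nz; have lb : (1 + b < size (wronskian y z))%N.
  by rewrite ltnNge; apply: contra nz => le; rewrite nth_default.
by move: ub lb; rewrite zS; move: (size (wronskian y z)) => n; lia.
Qed.

Lemma dvdXp_horner0 y : ('X %| y) = (y.[0] == 0).
Proof. by rewrite -[X in X %| _]subr0 -[0]/(0%:P) dvdp_XsubCl. Qed.

(** If z = x^(j+1) g, the Wronskian is x^j times (j+1) y g + x W(y, g). As y(0) is nonzero, one more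
    factor x in the Wronskian forces g(0) = 0. *)
Lemma order_partner y z e : y.[0] != 0 -> z.[0] = 0 ->
  'X^e %| wronskian y z -> 'X^(e.+1) %| z.
Proof.
move=> y0 z0 dvd_w.
suff H j : (j <= e)%N -> 'X^(j.+1) %| z by exact: H.
elim: j => [_|j IH je]; first by rewrite expr1 dvdXp_horner0 z0.
have /dvdpP[g gE] := IH (ltnW je).
have wE : wronskian y z = 'X^j * (j.+1%:R * (y * g) + 'X * wronskian y g).
  rewrite gE /wronskian derivM derivXn -pred_Sn exprS -[_ *+ j.+1]mulr_natl.
  by move: ('X^j) (j.+1%:R) => v n; ring.
have : 'X^(j.+1) %| 'X^j * (j.+1%:R * (y * g) + 'X * wronskian y g).
  by rewrite -wE; apply: dvdp_trans (dvdp_exp2l _ je) dvd_w.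
rewrite exprSr dvdp_mul2l ?expf_neq0 ?polyX_eq0 // dvdp_addl; last exact: dvdp_mulr.
rewrite dvdXp_horner0 !hornerM -polyC_natr hornerC !mulf_eq0 pnatr_eq0 (negPf y0) /= => g0.
by rewrite gE ['X^(j.+2)]exprS dvdp_mul2r ?expf_neq0 ?polyX_eq0 // dvdXp_horner0.
Qed.

Lemma wronskianDr y z1 z2 : wronskian y (z1 + z2) = wronskian y z1 + wronskian y z2.
Proof. by rewrite /wronskian derivD !mulrDr opprD addrACA. Qed.

Lemma wronskianZr y z c : wronskian y (c *: z) = c *: wronskian y z.
Proof. by rewrite /wronskian derivZ -!scalerAr scalerBr. Qed.

Lemma wronskian_diag y : wronskian y y = 0.
Proof. by rewrite /wronskian mulrC subrr. Qed.

Lemma wronskian_shift y z c : wronskian y (z + c *: y) = wronskian y z.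
Proof. by rewrite wronskianDr wronskianZr wronskian_diag scaler0 addr0. Qed.

Lemma horner0_deriv_neq0 y : coprimep y y^`() -> y.[0] = 0 -> (y^`()).[0] != 0.
Proof.
move=> cop y0; have := coprimep_root cop; move/(_ 0); apply.
by rewrite /root y0.
Qed.

(* When y(0) = 0, the solutions of the Wronskian equation vanish at 0 together
   with y; dividing both by X lowers the order of the Wronskian by 2. *)
Lemma partner_normalized y f e : coprimep y y^`() -> compat y y f ->
  (if y.[0] == 0 then (2 <= e)%N && ('X^e %| f) else 'X^(e.-1) %| f) ->
  (0 < e)%N ->
  exists2 z, wronskian y z = f & 'X^e %| z.
Proof.
move=> cop cmp dvd_f e0; have [z zE] := partner_exists cop cmp.
case: ifPn dvd_f => [/eqP y0 /andP[e2 dvd_f]|y0 dvd_f].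
  have /dvdpP[y1 y1E] : 'X %| y by rewrite dvdXp_horner0 y0.
  have y10 : y1.[0] != 0.
    have := horner0_deriv_neq0 cop y0.
    by rewrite y1E derivM derivX mulr1 !hornerE.
  have z0 : z.[0] = 0.
    have : 'X %| f by apply: dvdp_trans dvd_f; rewrite -(prednK e0) exprS dvdp_mulr.
    rewrite dvdXp_horner0 -zE /wronskian !hornerE y0 mul0r sub0r oppr_eq0.
    by rewrite mulf_eq0 (negPf (horner0_deriv_neq0 cop y0)) /= => /eqP.
  have /dvdpP[z1 z1E] : 'X %| z by rewrite dvdXp_horner0 z0.
  pose z2 := z1 + (- (z1.[0] / y1.[0])) *: y1.
  have z20 : z2.[0] = 0 by rewrite hornerD hornerZ mulNr divfK // subrr.
  have w2 : wronskian y (z2 * 'X) = 'X^2 * wronskian y1 z2.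
    by rewrite y1E /wronskian !derivM derivX; ring.
  exists (z2 * 'X).
    rewrite -zE y1E z1E /z2 mulrDl -scalerAl.
    by rewrite wronskian_shift.
  have : 'X^(e.-2) %| wronskian y1 z2.
    rewrite -(@dvdp_mul2l _ 'X^2) ?expf_neq0 ?polyX_eq0 // -w2 -exprD.
    rewrite (_ : (2 + e.-2)%N = e); last by lia.
    suff -> : wronskian y (z2 * 'X) = f by [].
    by rewrite -zE y1E z1E /z2 mulrDl -scalerAl wronskian_shift.
  move=> /(order_partner y10 z20) d.
  have -> : e = (e.-2.+1.+1)%N by lia.
  by rewrite exprSr dvdp_mul2r ?polyX_eq0.
pose z2 := z + (- (z.[0] / y.[0])) *: y.
exists z2; first by rewrite wronskian_shift.
have z20 : z2.[0] = 0 by rewrite hornerD hornerZ mulNr divfK // subrr.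
rewrite -(prednK e0); apply: (order_partner y0 z20).
by rewrite wronskian_shift zE.
Qed.

Lemma linear_cofactor z m : size z = m.+2 -> 'X^m %| z ->
  exists u c : F, c != 0 /\ z = c *: ('X^m * ('X - u%:P)).
Proof.
move=> sz /dvdpP[g gE].
have g0 : g != 0 by apply: contraTneq isT => g0; rewrite gE g0 mul0r size_poly0 in sz.
have g2 : size g = 2.
  move: sz; rewrite gE size_mul ?expf_neq0 ?polyX_eq0 // size_polyXn addnS /=.
  by move: (size g) => n; lia.
have lc0 : g`_1 != 0.
  by have := lead_coef_eq0 g; rewrite lead_coefE g2 /= => ->.
exists (- (g`_0 / g`_1)), g`_1; split=> //.
rewrite gE mulrC scalerAr; congr (_ * _).
apply/polyP => i; rewrite coefZ coefB coefX coefC.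
case: i => [|[|i]] /=; rewrite ?subr0 ?mulr1 //.
  by rewrite sub0r opprK mulrC divfK.
by rewrite nth_default ?g2 // ?subrr mulr0.
Qed.

(** Here deg z = e + 2 and z can be chosen divisible by x^(e+1), so one root u remains. Positivity
    of e is a conclusion: e = 0 would make z quadratic. *)
Lemma quadratic_partner y f e : size y = 3 -> coprimep y y^`() -> compat y y f ->
  size f = (e + 4)%N -> 'X^e %| f ->
  (y.[0] == 0 -> (0 < e)%N -> 'X^(e.+1) %| f) ->
  exists u c : F, [/\ c != 0, (0 < e)%N & wronskian y ('X^(e.+1) * ('X - u%:P)) = c *: f].
Proof.
move=> y3 cop cmp szf dvd_e dvd_e1.
have f4 z : wronskian y z = f -> (4 <= size (wronskian y z))%N by move=> ->; rewrite szf; lia.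
have e0 : (0 < e)%N.
  have [z zE] := partner_exists cop cmp.
  by have [-> ] := size_quadratic_partner y3 (f4 z zE); rewrite zE szf; lia.
have [||z zE dvd_z] := @partner_normalized y f e.+1 cop cmp => //.
  by case: ifP => // y0; rewrite ltnS e0 dvd_e1 ?y0.
have [sz _] := size_quadratic_partner y3 (f4 z zE).
have [|u [c [c0 zc]]] := @linear_cofactor z e.+1 _ dvd_z.
  by rewrite sz zE szf; lia.
exists u, c^-1; split; rewrite ?invr_eq0 //.
by rewrite -zE zc wronskianZr scalerA mulVf // scale1r.
Qed.

(** Here deg z = e + 1 and z can be chosen divisible by x^(e+1), hence is a power up to a scalar. If
    y(0) were 0, it could be chosen divisible by x^(e+2), beyond its degree. *)
Lemma quadratic_partner_power y f e : size y = 3 -> coprimep y y^`() -> compat y y f ->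
  (0 < e)%N -> size f = (e + 3)%N -> 'X^e %| f ->
  (y.[0] == 0 -> 'X^(e.+2) %| f) ->
  exists c, [/\ c != 0, y.[0] != 0 & wronskian y 'X^(e.+1) = c *: f].
Proof.
move=> y3 cop cmp e0 szf dvd_e dvd_e2.
have f4 z : wronskian y z = f -> (4 <= size (wronskian y z))%N by move=> ->; rewrite szf; lia.
have y0 : y.[0] != 0.
  apply/negP => /eqP y0; have [||z zE dvd_z] := @partner_normalized y f e.+2 cop cmp => //.
    by rewrite y0 eqxx /= dvd_e2 // y0.
  have [sz _] := size_quadratic_partner y3 (f4 z zE).
  have z0 : z != 0 by rewrite -size_poly_eq0 sz zE szf; lia.
  by have := dvdp_leq z0 dvd_z; rewrite size_polyXn sz zE szf; lia.
have [||z zE dvd_z] := @partner_normalized y f e.+1 cop cmp => //.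
  by rewrite (negPf y0).
have [sz _] := size_quadratic_partner y3 (f4 z zE).
have z0 : z != 0 by rewrite -size_poly_eq0 sz zE szf; lia.
have /dvdp_size_eqp : ('X^(e.+1) %| z) := dvd_z.
rewrite size_polyXn sz zE szf (_ : (e + 3).-1 = e.+2); last by lia.
rewrite eqxx => /esym /eqpf_eq [c c0 cE].
exists c; split => //; by rewrite -zE cE wronskianZr.
Qed.

End Wronskian.

(** * Bethe equations and Wronskians for a power of x times a linear factor *)

Section PowerTimesLinear.
Variable F : numFieldType.

Definition power_linear (m : nat) (u : F) : {poly F} := 'X^m * ('X - u%:P).

Lemma power_linear_neq0 m u : power_linear m u != 0.
Proof. by rewrite mulf_neq0 ?expf_neq0 ?polyX_eq0 ?polyXsubC_eq0. Qed.

Lemma size_power_linear m u : size (power_linear m u) = m.+2.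
Proof. by rewrite size_monicM ?monicXn ?polyXsubC_eq0 // size_polyXn size_XsubC addnC. Qed.

(** Multiplying the derivative by x avoids the exponent m - 1 and a separate case m = 0 later. *)
Lemma mulX_derivXn (m : nat) : 'X * ('X^m)^`() = m%:R * 'X^m :> {poly F}.
Proof.
case: m => [|m]; first by rewrite derivXn mulr0n mulr0 mul0r.
by rewrite derivXn mulrnAr -exprS mulr_natl.
Qed.

(** At u, the ratio y''/y' is 2m/u for y = x^m (x - u), while f'/f is e/u + 1/(u - w) for f = x^e (x
    - w). The relation is their equality with denominators cleared. *)
Lemma compat_power_linear m e u w : u != 0 ->
  compat ('X - u%:P) (power_linear m u) ('X^e * ('X - w%:P)) ->
  (m.*2%:R - e%:R) * (u - w) = u.
Proof.
move=> u0; rewrite /compat dvdp_XsubCl /root => /eqP.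
have ev n : u * ('X^n)^`().[u] = n%:R * u ^+ n.
  have := congr1 (horner^~ u) (mulX_derivXn n).
  by rewrite !hornerM hornerX -polyC_natr hornerC hornerXn.
rewrite /power_linear !(derivM, derivD, derivN, derivX, derivC) !hornerE subrr.
have := ev m; have := ev e.
move: (('X^m)^`()^`().[u]) => q2; move: (('X^m)^`().[u]) (('X^e)^`().[u]) => q p pE qE.
have um : u ^+ m != 0 by rewrite expf_neq0.
have ue : u ^+ e != 0 by rewrite expf_neq0.
move: (u ^+ m) (u ^+ e) um ue pE qE => x z x0 z0 pE qE H.
apply/eqP; rewrite -subr_eq0; apply/eqP; apply: (mulfI x0); apply: (mulfI z0).
rewrite mulr0 mulr0 -[RHS](mulr0 u) -H -muln2 natrM.
rewrite ?(mulr0, mul0r, addr0, add0r, subr0, mulr1, oppr0).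
transitivity (z * (u - w) * ((u * q) *+ 2) - (u * p) * (u - w) * x - u * z * x).
  by rewrite pE qE; ring.
by rewrite /=; ring.
Qed.

(** The hypothesis on u and w is what [compat_power_linear] becomes when e + 1 = m + A; so the Bethe
    equation makes x^A a partner. *)
Lemma wronskian_power_linear m A e u w : (e.+1 = m + A)%N ->
  (A%:R - m%:R - 1) * w = (A%:R - m%:R) * u ->
  wronskian (power_linear m u) 'X^A =
  (A%:R - m%:R - 1) *: ('X^e * ('X - w%:P)).
Proof.
move=> eE rel; have X0 : ('X : {poly F}) != 0 by rewrite polyX_eq0.
apply: (mulfI X0); rewrite -scalerAr -mul_polyC.
have -> : 'X * wronskian (power_linear m u) 'X^A =
   'X^m * 'X^A * ((A%:R - m%:R - 1) * 'X - ((A%:R - m%:R) * u)%:P).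
  rewrite /wronskian /power_linear derivM derivB derivX derivC.
  transitivity ('X^m * ('X - u%:P) * ('X * ('X^A)^`()) -
    ('X * ('X^m)^`() * ('X - u%:P) + 'X * 'X^m * (1 - 0)) * 'X^A); first by ring.
  rewrite !mulX_derivXn !polyCM !polyCB !polyC_natr; ring.
rewrite -rel -exprD -eE exprS !polyCM !polyCB !polyC_natr polyC1.
by move: (A%:R - m%:R - 1 : {poly F}) => c; ring.
Qed.

(** If y(u) were 0, the Wronskian at u would be - y'(u) z(u), so y'(u) would vanish as well, against
    separability. Hence [compat_neighbour] applies. *)
Lemma compat_at_root (u : F) (y z f g : {poly F}) : coprimep y y^`() -> ('X - u%:P) %| wronskian y z ->
  z.[u] != 0 -> compat ('X - u%:P) f (y * g) -> compat ('X - u%:P) f (z * g).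
Proof.
move=> cop dvd_w zu; apply: compat_neighbour => //.
rewrite coprimep_sym coprimep_XsubC /root; apply: contraNneq zu => yu.
move: dvd_w; rewrite dvdp_XsubCl /root /wronskian !hornerE yu mul0r sub0r oppr_eq0.
rewrite mulf_eq0 => /orP[/eqP y'u|//].
have := coprimep_root cop; move/(_ u); rewrite /root yu eqxx => /(_ isT).
by rewrite y'u eqxx.
Qed.

End PowerTimesLinear.

(** * From powers times linear factors to pure powers of x *)

Section PathToPowers.
Variables (F : numFieldType) (r : nat) (lam : 'I_r -> nat).
Hypothesis r2 : (2 <= r)%N.
Local Notation la := (at1 0%N lam).
Local Notation DY Y := (Dlambda lam (@ratfun_tuple F r Y)).

Definition update (T : Type) (f : nat -> T) (k : nat) (v : T) (i : nat) : T :=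
  if i == k then v else f i.

Lemma Dlambda_update (Y : nat -> {poly F}) k z c : (0 < k <= r)%N ->
  Y 0%N = 'X - 1 -> (forall j, Y j != 0) -> z != 0 ->
  wronskian (Y k) z = c *: neighbours lam Y k -> DY Y = DY (update Y k z).
Proof.
move=> kr Y0 Yn0 z0 w; apply: (Dlambda_swap r2 kr Y0 Yn0).
- by move=> j; rewrite /update; case: ifP.
- by move=> j /negPf jk; rewrite /update jk.
- by rewrite /update eqxx; exact: w.
Qed.

Lemma Dlambda_ext (Y Z : nat -> {poly F}) :
  (forall i, (0 < i <= r)%N -> Y i = Z i) -> DY Y = DY Z.
Proof.
move=> eqYZ; congr (Dlambda lam _); apply: boolp.funext => i.
by rewrite /ratfun_tuple eqYZ ?ltn_ord.
Qed.

(** Indices j, ..., 1 are treated in decreasing order. The first numerical hypothesis is the degree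
    balance of the Wronskian equation. The Bethe equation at j has the power x^(B_(j+1)) as upper
    neighbour, those at lower indices still have [N i.+1]. *)
Lemma path_to_powers j (m : nat -> nat) (u : nat -> F) (B : nat -> nat) Y :
  let N i := power_linear (m i) (u i) in
  (j < r)%N -> m 0%N = 0%N -> u 0%N = 1 ->
  (forall i, (0 < i <= j)%N -> (la i + m i.-1 + B i.+1).+1 = (m i + B i)%N) ->
  (forall i, (0 < i <= j)%N -> (m i < B i)%N) ->
  (forall i, (0 < i < j)%N -> (N i.+1).[u i] != 0 ->
     compat ('X - (u i)%:P) (N i) (N i.+1 * ('X^(la i) * N i.-1))) ->
  ((0 < j)%N -> u j != 0 /\
     compat ('X - (u j)%:P) (N j) ('X^(B j.+1) * ('X^(la j) * N j.-1))) ->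
  (forall i, (i <= j)%N -> Y i = N i) -> (forall i, (j < i)%N -> Y i = 'X^(B i)) ->
  DY Y = DY (fun i => 'X^(B i)).
Proof.
move=> N; elim: j Y => [|j IH] Y jr m0 u0 recB ltB compN compNj YN YB.
  by apply: Dlambda_ext => i /andP[i0 _]; apply: YB.
have [uj0 cj] := compNj isT.
have mj := ltB j.+1 (leqnn _); have recj := recB j.+1 (leqnn _).
have NE : 'X^(B j.+2) * ('X^(la j.+1) * N j) =
    'X^(la j.+1 + m j + B j.+2) * ('X - (u j)%:P).
  by rewrite /N /power_linear !exprD; ring.
rewrite NE in cj; have rel := compat_power_linear uj0 cj.
set e := (la j.+1 + m j + B j.+2)%N in recj rel NE cj *.
(* The Bethe equation at the top root, with e + 1 = m + B; it also passes nonvanishing from u_(j+1)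
   down to u_j. *)
have rel' : ((B j.+1)%:R - (m j.+1)%:R - 1) * u j = ((B j.+1)%:R - (m j.+1)%:R) * u j.+1.
  have eF : e%:R + 1 = (m j.+1)%:R + (B j.+1)%:R :> F by rewrite -natrD -recj natr1.
  have eE : e%:R = (m j.+1)%:R + (B j.+1)%:R - 1 :> F by rewrite -eF addrK.
  apply/eqP; rewrite -subr_eq0; apply/eqP.
  transitivity (((m j.+1).*2%:R - e%:R) * (u j.+1 - u j) - u j.+1); last first.
    by rewrite rel subrr.
  by rewrite eE -muln2 natrM; ring.
have w := wronskian_power_linear recj rel'.
have BmF : (B j.+1)%:R - (m j.+1)%:R != 0 :> F by rewrite subr_eq0 eqr_nat gtn_eqF.
have uj : u j != 0.
  have : ((B j.+1)%:R - (m j.+1)%:R) * u j.+1 != 0 by rewrite mulf_neq0.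
  by rewrite -rel'; apply: contraNneq => ->; rewrite mulr0.
have uju : u j != u j.+1.
  apply: contraNneq uj0 => E; move: rel'; rewrite E mulrBl mul1r => /eqP.
  by rewrite -subr_eq0 addrAC subrr sub0r oppr_eq0.
have Yn0 i : Y i != 0.
  by case: (leqP i j.+1) => [/YN->|/YB->]; rewrite ?power_linear_neq0 ?expf_neq0 ?polyX_eq0.
have nbE : neighbours lam Y j.+1 = 'X^e * ('X - (u j)%:P).
  by rewrite /neighbours jr YN ?YB // -NE; ring.
have XB0 : 'X^(B j.+1) != 0 :> {poly F} by rewrite expf_neq0 ?polyX_eq0.
have Y00 : Y 0%N = 'X - 1 by rewrite YN // /N /power_linear m0 u0 expr0 mul1r polyC1.
have wY : wronskian (Y j.+1) 'X^(B j.+1) =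
    ((B j.+1)%:R - (m j.+1)%:R - 1) *: neighbours lam Y j.+1 by rewrite nbE YN.
have jr' : (0 < j.+1 <= r)%N by apply: ltnW.
apply: (etrans (Dlambda_update jr' Y00 Yn0 XB0 wY)).
apply: (IH _ (ltnW jr) m0 u0).
- by move=> i /andP[i0 ij]; apply: recB; rewrite i0 leqW.
- by move=> i /andP[i0 ij]; apply: ltB; rewrite i0 leqW.
- by move=> i /andP[i0 ij]; apply: compN; rewrite i0 leqW.
(* The upper neighbour of index j has just become a power of x. Its Wronskian with the old neighbour
   vanishes at u_j, so the Bethe equation there is transferred. *)
- move=> j0; split=> //; apply: (@compat_neighbour _ _ _ (N j.+1)).
  + rewrite coprimep_sym coprimep_XsubC /root /N /power_linear !hornerE.
    by rewrite mulf_eq0 expf_eq0 (negPf uj) andbF /= subr_eq0.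
  + rewrite w; case: (eqVneq ((B j.+1)%:R - (m j.+1)%:R - 1 : F) 0) => [->|c0].
      by rewrite scale0r dvdp0.
    by rewrite dvdpZr // dvdp_mull.
  + apply: compN; rewrite ?j0 ?leqnn //.
    rewrite /N /power_linear !hornerE mulf_eq0 expf_eq0 (negPf uj) andbF /=.
    by rewrite subr_eq0.
- by move=> i ij; rewrite /update ltn_eqF ?YN // leqW.
- move=> i ij; rewrite /update; case: eqP => [->//|/eqP ne]; apply: YB.
  by rewrite ltn_neqAle eq_sym ne.
Qed.

End PathToPowers.

(** * Tuples satisfying the polynomial form of the Bethe equations *)

Section GenericTuples.
Variables (F : numFieldType) (r : nat) (lam : 'I_r -> nat).
Hypothesis r2 : (2 <= r)%N.
Local Notation la := (at1 0%N lam).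
Local Notation DY Y := (Dlambda lam (@ratfun_tuple F r Y)).

(** Component 0 carries the point 1, so [bethe_adjacent] at index 1 says that y_1(1) is nonzero;
    [bethe_zero] records that roots avoid the point 0 when lambda_i is positive. *)
Record bethe_tuple (Y : nat -> {poly F}) : Prop := BetheTuple {
  bethe_tuple0 : Y 0%N = 'X - 1;
  bethe_compat : forall i, (0 < i <= r)%N -> compat (Y i) (Y i) (neighbours lam Y i);
  bethe_simple : forall i, (0 < i <= r)%N -> coprimep (Y i) (Y i)^`();
  bethe_adjacent : forall i, (0 < i <= r)%N -> coprimep (Y i) (Y i.-1);
  bethe_zero : forall i, (0 < i <= r)%N -> (Y i).[0] == 0 -> la i = 0%N }.

(** The components are already linear, so [path_to_powers] applies with all m_i = 0 once the top
    root is known to be nonzero. *)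
Lemma bethe_linear_chain (Y : nat -> {poly F}) k (u : nat -> F) (B : nat -> nat) :
  bethe_tuple Y -> (k < r)%N ->
  (forall i, (i <= k)%N -> Y i = 'X - (u i)%:P) ->
  (forall i, (k < i)%N -> Y i = 1) ->
  (forall i, (0 < i <= k)%N -> B i = (la i + B i.+1).+1) ->
  (forall i, (k < i)%N -> B i = 0%N) ->
  DY Y = DY (fun i => 'X^(B i)).
Proof.
move=> bY kr Yu Y1 recB B0.
have NE i : power_linear 0 (u i) = 'X - (u i)%:P by rewrite /power_linear expr0 mul1r.
have u0 : u 0%N = 1.
  by have := bethe_tuple0 bY; rewrite Yu // => /addrI/oppr_inj/polyC_inj.
apply: (@path_to_powers F r lam r2 k (fun=> 0%N) u B) => //.
- by move=> i ik; rewrite addn0 add0n (recB i).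
- by move=> i ik; rewrite (recB i).
- move=> i /andP[i0 ik] _.
  have := bethe_compat bY (i := i); rewrite /neighbours (ltn_trans ik kr) i0 /=.
  rewrite ltnW ?(ltn_trans ik kr) // => /(_ isT).
  rewrite !NE !Yu ?(ltnW ik) //; last by lia.
  by rewrite mulrA [X in compat _ _ X -> _]mulrC.
- move=> k0; have kr' : (0 < k <= r)%N by rewrite k0 ltnW.
  have := bethe_compat bY kr'; rewrite /neighbours kr (Y1 k.+1) // !Yu ?leqnn ?leq_pred //.
  rewrite mulr1 !NE B0 // expr0 mul1r => cmp; split=> //.
  (* If u_k = 0, then lambda_k = 0 and the Bethe equation at k says that x - u_k divides -1. *)
  apply/eqP => uk; have la0 : la k = 0%N.
    by apply: (bethe_zero bY kr'); rewrite Yu // uk hornerXsubC subrr.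
  have d2 : ('X - (u k)%:P)^`()^`() = 0 by rewrite derivXsubC -[1]/(1%:P) derivC.
  move: cmp; rewrite la0 expr0 mul1r /compat d2 mulr0 sub0r !derivXsubC mulr1.
  by rewrite dvdp_XsubCl /root !hornerE oppr_eq0 oner_eq0.
- by move=> i ik; rewrite NE Yu.
- by move=> i ki; rewrite Y1 // B0.
Qed.

(** * Tuples with quadratic components *)

Section FirstPass.
Variables (Y : nat -> {poly F}) (k : nat) (u0 : nat -> F).
Hypothesis bY : bethe_tuple Y.
Hypothesis kr : (k < r)%N.
Hypothesis Yu : forall i, (i <= k)%N -> Y i = 'X - (u0 i)%:P.
Hypothesis Y3 : forall i, (k < i <= r)%N -> size (Y i) = 3.

(** The exponent m_a of the component x^(m_a) (x - u_a) that replaces y_a in the first pass. It is 0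
    for a <= k, where y_a is kept. *)
Definition lowest_exponent (a : nat) := (\sum_(k.+1 <= b < a.+1) (la b).+1)%N.
Local Notation m := lowest_exponent.
Local Notation N u a := (power_linear (m a) (u a)).

Lemma lowest_exponent_small a : (a <= k)%N -> m a = 0%N.
Proof. by move=> ak; rewrite /m big_geq. Qed.

Lemma lowest_exponentS a : (k <= a)%N -> m a.+1 = (m a + (la a.+1).+1)%N.
Proof. by move=> ka; rewrite /m big_nat_recr. Qed.

Lemma size_first_pass_rhs (u : nat -> F) i : (k <= i)%N -> (i.+1 < r)%N ->
  size ('X^(la i.+1) * (N u i * Y i.+2)) = (la i.+1 + m i + 4)%N.
Proof.
move=> ki ir.
have Y3' : size (Y i.+2) = 3 by apply: Y3; lia.
have Y0 : Y i.+2 != 0 by rewrite -size_poly_eq0 Y3'.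
have N0 : N u i != 0 := power_linear_neq0 _ _.
rewrite (size_monicM (monicXn _ _) (mulf_neq0 N0 Y0)) (size_mul N0 Y0).
by rewrite size_power_linear Y3' size_polyXn /=; lia.
Qed.

Lemma bethe_not_both i : (0 < i <= r)%N -> (Y i).[0] == 0 -> (Y i.-1).[0] == 0 -> False.
Proof.
move=> ir y0 y1; have := coprimep_root (bethe_adjacent bY ir).
by move/(_ 0 y0); rewrite y1.
Qed.

(** One reproduction step for each index. The third clause keeps the Bethe equation at the next
    index with its new lower neighbour; the last one supplies the extra factor x that
    [quadratic_partner] asks for when the next component vanishes at 0. *)
Lemma first_pass i : (k <= i < r)%N -> exists u : nat -> F,
  [/\ forall a, (a <= k)%N -> u a = u0 a,
      forall a, (k < a <= i)%N -> exists2 c : F, c != 0 &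
        wronskian (Y a) (N u a) = c *: ('X^(la a) * (N u a.-1 * Y a.+1)),
      compat (Y i.+1) (Y i.+1)
        ('X^(la i.+1) * (if (i.+1 < r)%N then N u i * Y i.+2 else N u i ^+ 2)) &
      (k < i)%N -> (Y i.+1).[0] == 0 -> u i = 0].
Proof.
elim: i => [|i IH] /andP[ki ir].
  exists u0; split=> //; try by move=> *; lia.
  have := bethe_compat bY (i := 1%N); rewrite (ltnW r2) => /(_ isT).
  rewrite /neighbours /= /power_linear lowest_exponent_small // expr0 mul1r.
  by rewrite -Yu.
case: (ltngtP k i.+1) ki => // [ki _|kE _]; last first.
  exists u0; split=> //; try by move=> *; lia.
  have := bethe_compat bY (i := i.+2); rewrite ir => /(_ isT).
  rewrite /neighbours /= /power_linear lowest_exponent_small ?kE // expr0 mul1r.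
  by rewrite -Yu ?kE.
have [|u [uu0 uW cmp u_zero]] := IH; first by rewrite (ltnW ir) -ltnS ki.
have ki' : (k <= i)%N by lia.
rewrite ir in cmp.
pose f := 'X^(la i.+1) * (N u i * Y i.+2); rewrite -/f in cmp.
have szf : size f = (la i.+1 + m i + 4)%N by exact: size_first_pass_rhs.
have fE : f = 'X^(la i.+1 + m i) * (('X - (u i)%:P) * Y i.+2).
  by rewrite /f /power_linear exprD; ring.
have ir1 : (0 < i.+1 <= r)%N by lia.
have ir2 : (0 < i.+2 <= r)%N by lia.
have dvd_e : 'X^(la i.+1 + m i) %| f by rewrite fE dvdp_mulr.
have [] := @quadratic_partner F (Y i.+1) f (la i.+1 + m i).
- by apply: Y3; lia.
- exact: bethe_simple.
- exact: cmp.
- exact: szf.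
- exact: dvd_e.
(* Here lambda_(i+1) = 0, so a positive exponent comes from m_i, which means k < i; then u_i = 0
   gives the extra factor x. *)
- move=> y0; rewrite (bethe_zero bY ir1 y0) add0n => mi0.
  have ki2 : (k < i)%N by move: mi0; case: (ltnP k i) => // /lowest_exponent_small ->.
  rewrite fE (bethe_zero bY ir1 y0) add0n (u_zero ki2 y0) subr0 exprSr mulrA.
  exact: dvdp_mulr.
move=> v [c [c0 e0 w]].
have mS : m i.+1 = (la i.+1 + m i).+1 by rewrite lowest_exponentS // addnC.
rewrite -mS -/(power_linear _ _) in w.
exists (update u i.+1 v); split.
- by move=> a ak; rewrite /update ltn_eqF ?uu0 //; lia.
- move=> a /andP[ka ai]; have [->|ne] := eqVneq a i.+1.
    by exists c; rewrite // /update eqxx /= ltn_eqF ?ltnSn.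
  have ai' : (a <= i)%N by lia.
  have [|c' c'0 w'] := uW a; first by rewrite ka.
  by exists c'; rewrite // /update ltn_eqF ?ltnS // ltn_eqF //; lia.
- have := bethe_compat bY ir2; rewrite /neighbours /=.
  have cop := bethe_adjacent bY ir2; rewrite /= in cop.
  have dvd_w : Y i.+2 %| wronskian (Y i.+1) (N (update u i.+1 v) i.+1).
    by rewrite /update eqxx w dvdpZr // /f mulrA dvdp_mull.
  case: ifP => _.
    move=> cmp2; have -> : 'X^(la i.+2) * (N (update u i.+1 v) i.+1 * Y i.+3) =
       N (update u i.+1 v) i.+1 * ('X^(la i.+2) * Y i.+3) by ring.
    by apply: (compat_neighbour cop dvd_w); rewrite mulrCA.
  move=> cmp2; move: dvd_w; move: (N (update u i.+1 v) i.+1) => z dvd_w.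
  have -> : 'X^(la i.+2) * z ^+ 2 = z * (z * 'X^(la i.+2)) by ring.
  apply: (compat_neighbour cop dvd_w); rewrite mulrCA.
  by apply: (compat_neighbour cop dvd_w); rewrite mulrA -expr2 mulrC.
(* A zero of y_(i+2) at 0 raises the order of the Wronskian at 0, hence that of the new component,
   and this forces v = 0. *)
- move=> _ y2; rewrite /update eqxx.
  have y1 : (Y i.+1).[0] != 0.
    by apply/negP => y1; exact: (bethe_not_both ir2 y2 y1).
  have : 'X^((la i.+1 + m i).+1) %| wronskian (Y i.+1) (power_linear (m i.+1) v).
    rewrite w dvdpZr // fE exprSr dvdp_mul // dvdp_mull //.
    by rewrite dvdXp_horner0.
  move=> /(order_partner y1); rewrite mS /power_linear !hornerE => /(_ _).
  rewrite exprS mul0r mul0r => /(_ erefl).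
  rewrite exprSr dvdp_mul2l ?expf_neq0 ?polyX_eq0 // dvdXp_horner0 !hornerE oppr_eq0.
  by move/eqP.
Qed.

Lemma lowest_exponent_leq i j : (k <= i)%N -> (i <= j)%N -> (m i <= m j)%N.
Proof.
move=> ki; elim: j => [|j IH]; first by rewrite leqn0 => /eqP->.
rewrite leq_eqVlt => /orP[/eqP->//|]; rewrite ltnS => ij.
by rewrite lowest_exponentS ?(leq_trans ki) // (leq_trans (IH ij)) // leq_addr.
Qed.

(** For lambda_r = 0 the quadratic y_r would divide L y_r'' - 2 y_r' with L linear and prime to y_r.
    This polynomial has degree exactly 1: its leading coefficient is -2 times that of y_r. *)
Lemma short_root_nondegenerate : k = r.-1 -> la r != 0%N.
Proof.
move=> kE; apply/eqP => la0; have r1 : (0 < r <= r)%N by rewrite leqnn ltnW.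
have Yp : Y r.-1 = 'X - (u0 k)%:P by rewrite -kE Yu.
have Yr3 : size (Y r) = 3 by rewrite Y3 // kr leqnn.
have cop := bethe_adjacent bY r1; rewrite Yp in cop.
have := bethe_compat bY r1; rewrite /neighbours ltnn la0 expr0 mul1r Yp /compat.
set L := 'X - _ in cop *.
have -> : L ^+ 2 * (Y r)^`()^`() - (L ^+ 2)^`() * (Y r)^`() =
    L * (L * (Y r)^`()^`() - (Y r)^`() *+ 2).
  by rewrite expr2 derivM derivXsubC; ring.
rewrite Gauss_dvdpr // => dvd_r.
have top : (L * (Y r)^`()^`() - (Y r)^`() *+ 2)`_1 = - ((Y r)`_2 *+ 2).
  rewrite coefB coefMn !coef_deriv mulrBl coefB coefXM coefCM !coef_deriv.
  by rewrite [(Y r)`_3]nth_default ?Yr3 // !mul0rn mulr0 subr0 /=; ring.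
have lc : (Y r)`_2 != 0.
  by have := lead_coef_eq0 (Y r); rewrite lead_coefE Yr3 /= => ->; rewrite -size_poly_eq0 Yr3.
have nz : L * (Y r)^`()^`() - (Y r)^`() *+ 2 != 0.
  apply/eqP => E; move: top; rewrite E coef0 => /esym/eqP.
  by rewrite oppr_eq0 mulrn_eq0 (negPf lc).
have := dvdp_leq nz dvd_r; rewrite Yr3 leqNgt => /negP; apply.
rewrite ltnS; apply/leq_sizeP => j j2.
rewrite coefB coefMn !coef_deriv mulrBl coefB coefXM coefCM !coef_deriv.
by case: j j2 => [|[|j]] // _; rewrite /= !nth_default ?Yr3 // ?mul0rn ?mulr0 !subr0.
Qed.

Hypothesis Yn0 : forall i, Y i != 0.

(** At index r, after the first pass, the Wronskian equation has right-hand side x^e (x - u_s)^2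
    with s = r - 1 and e = lambda_r + 2 m_s. Its partner is x^(e+1), which explains the constant
    value of B beyond k. *)
Lemma bethe_quadratic_chain (B : nat -> nat) :
  (forall i, (0 < i <= k)%N -> B i = (la i + B i.+1).+1) ->
  (forall i, (k < i)%N -> B i = (la r + (m r.-1).*2).+1) ->
  DY Y = DY (fun i => 'X^(B i)).
Proof.
move=> recB BA; pose s := r.-1; have rE : r = s.+1 by rewrite /s prednK // ltnW.
have ks : (k <= s)%N by lia.
have [|u [uu0 uW cmp u_zero]] := @first_pass s; first by rewrite ks rE /=.
have r1 : (0 < r <= r)%N by rewrite leqnn ltnW.
have NY a : (a <= k)%N -> N u a = Y a.
  by move=> ak; rewrite /power_linear lowest_exponent_small // expr0 mul1r Yu ?uu0.
have u01 : u 0%N = 1.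
  have := bethe_tuple0 bY; rewrite Yu // -uu0 //.
  by move=> /addrI/oppr_inj/polyC_inj.
rewrite -rE ltnn in cmp u_zero.
pose e := (la r + (m s).*2)%N; pose A := e.+1.
have fE : 'X^(la r) * N u s ^+ 2 = 'X^e * ('X - (u s)%:P) ^+ 2.
  by rewrite /e /power_linear exprMn -exprM muln2 mulrA -exprD.
have e0 : (0 < e)%N.
  case: (ltngtP k s) ks => // [ks _|kE _].
    have := @lowest_exponentS s.-1; rewrite (_ : s.-1.+1 = s); last by lia.
    by rewrite /e => ->; lia.
  by have := short_root_nondegenerate kE; rewrite /e; lia.
rewrite fE in cmp.
have Yr3 : size (Y r) = 3 by rewrite Y3 ?kr /=.
have szf : size ('X^e * ('X - (u s)%:P) ^+ 2) = (e + 3)%N.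
  rewrite (size_monicM (monicXn _ _)) ?expf_neq0 ?polyXsubC_eq0 // size_polyXn.
  by rewrite size_exp_XsubC /=; lia.
have dvd_e : 'X^e %| 'X^e * ('X - (u s)%:P) ^+ 2 by rewrite dvdp_mulr.
have zero_r : (Y r).[0] == 0 -> 'X^(e.+2) %| 'X^e * ('X - (u s)%:P) ^+ 2.
  move=> y0; have la0 := bethe_zero bY r1 y0.
  have ks' : (k < s)%N.
    rewrite ltn_neqAle ks andbT; apply: contraTneq e0 => kE.
    by rewrite /e la0 -kE lowest_exponent_small.
  by rewrite (u_zero ks' y0) subr0 -exprD addn2.
have [c [c0 yr0 w]] :=
  quadratic_partner_power Yr3 (bethe_simple bY r1) cmp e0 szf dvd_e zero_r.
(* If u_s were 0, the Wronskian would have order at least e + 2 at 0, and x^(e+1) would be divisible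
   by x^(e+3). *)
have us0 : u s != 0.
  apply/eqP => us; have : 'X^(e.+2) %| wronskian (Y r) 'X^A.
    by rewrite w us subr0 -exprD addn2 dvdpZr.
  move=> /(order_partner yr0); rewrite hornerXn expr0n /= => /(_ erefl).
  move=> /dvdp_leq; rewrite expf_neq0 ?polyX_eq0 // => /(_ isT).
  by rewrite !size_polyXn /A; lia.
(* The tuple once the first pass has dealt with the indices up to j. *)
pose state j a := if (a <= j)%N then N u a else Y a.
have state0 j a : state j a != 0 by rewrite /state; case: ifP; rewrite ?power_linear_neq0.
have stateX j : state j 0%N = 'X - 1.
  by rewrite /state NY // (bethe_tuple0 bY).
have to_state j : (k <= j)%N -> (j < r)%N -> DY Y = DY (state j).
  elim: j => [|j IH].
    rewrite leqn0 => /eqP k0 _; apply: Dlambda_ext => i /andP[i0 _].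
    by rewrite /state leqNgt i0.
  rewrite leq_eqVlt => /orP[/eqP kE _|kj jr].
    apply: Dlambda_ext => i _; rewrite /state; case: ifP => [ij|_]; last by [].
    by apply/esym/NY; rewrite kE.
  have jr1 : (0 < j.+1 <= r)%N by apply: ltnW.
  have [|c' c'0 w'] := uW j.+1; first by rewrite kj; lia.
  have nb : wronskian (state j j.+1) (N u j.+1) = c' *: neighbours lam (state j) j.+1.
    have sj : state j j = N u j by rewrite /state leqnn.
    have sj1 : state j j.+1 = Y j.+1 by rewrite /state ltnn.
    have sj2 : state j j.+2 = Y j.+2 by rewrite /state ltnNge ltnW.
    by rewrite /neighbours jr sj1 sj2 succnK sj w' succnK.
  apply: (etrans (IH kj (ltnW jr))).
  apply: (etrans (Dlambda_update r2 jr1 (stateX j) (state0 j) (power_linear_neq0 _ _) nb)).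
  apply: Dlambda_ext => i _; rewrite /update /state.
  case: (ltngtP i j.+1) => [ij|ij|->]; last by [].
  - by rewrite -ltnS ij.
  - by rewrite leqNgt ltnW.
have leqNs : (r <= s)%N = false by rewrite rE ltnn.
have ltr_s i : (i < r)%N = (i <= s)%N by rewrite rE ltnS.
have nbr : wronskian (state s r) 'X^A = c *: neighbours lam (state s) r.
  have ss : state s s = N u s by rewrite /state leqnn.
  have sr1 : state s r = Y r by rewrite /state leqNs.
  by rewrite /neighbours ltnn sr1 -/s ss fE w.
have XA0 : 'X^A != 0 :> {poly F} by rewrite expf_neq0 ?polyX_eq0.
have sr : (s < r)%N by rewrite rE.
apply: (etrans (to_state s ks sr)).
apply: (etrans (Dlambda_update r2 r1 (stateX s) (state0 s) XA0 nbr)).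
pose Z a := if (a < r)%N then N u a else 'X^(B a).
have BAs i : (k < i)%N -> B i = A by move=> ki; rewrite BA.
apply: (@etrans _ _ (DY Z)).
  apply: Dlambda_ext => i /andP[_ ir]; rewrite /update /state /Z.
  case: eqP => [->|/eqP ne]; first by rewrite ltnn BAs.
  have ir' : (i < r)%N by rewrite ltn_neqAle ne.
  by rewrite ir' -ltr_s ir'.
(* Bethe equation at u_i with the original upper neighbour: given for i <= k, and a consequence of
   the Wronskian equation of the first pass beyond k. *)
have base i : (0 < i <= s)%N ->
    compat ('X - (u i)%:P) (N u i) (Y i.+1 * ('X^(la i) * N u i.-1)).
  move=> /andP[i0 is1]; rewrite mulrC -mulrA; case: (leqP i k) => [ik|ki].
    have ir : (0 < i <= r)%N by rewrite i0 rE leqW.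
    have := bethe_compat bY ir; rewrite /neighbours ltr_s is1.
    rewrite NY // NY; last by lia.
    by rewrite [in compat (Y i)]Yu // uu0.
  have [|c' c'0 w'] := uW i; first by rewrite ki is1.
  have := wronskian_compat c'0 w'; apply: dvdp_trans.
  by rewrite /power_linear dvdp_mull.
apply: (@path_to_powers F r lam r2 s m u B Z) => //.
- exact: lowest_exponent_small.
- move=> i /andP[i0 is1]; case: (leqP i k) => [ik|ki].
    rewrite !lowest_exponent_small //; last by lia.
    by rewrite addn0 add0n (recB i) // i0.
  rewrite !BAs //; last by lia.
  have ki' : (k <= i.-1)%N by lia.
  by have := lowest_exponentS ki'; rewrite (prednK i0) => ->; lia.
- move=> i /andP[i0 is1]; case: (leqP i k) => [ik|ki].
    by rewrite lowest_exponent_small // (recB i) // i0.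
  by rewrite BAs // /A /e; have := lowest_exponent_leq (ltnW ki) is1; lia.
- move=> i /andP[i0 is1] Nu; have := base i; rewrite i0 ltnW // => /(_ isT).
  case: (leqP i.+1 k) => [ik|ki]; first by rewrite -NY.
  have ir1 : (0 < i.+1 <= r)%N by rewrite ltr_s (ltnW is1).
  apply: (compat_at_root (bethe_simple bY ir1) _ Nu).
  have [|c' c'0 w'] := uW i.+1; first by rewrite ki is1.
  by rewrite w' dvdpZr // dvdp_mull // dvdp_mulr // /power_linear dvdp_mull.
- move=> s0; split=> //; have := base s; rewrite s0 leqnn => /(_ isT).
  rewrite -rE BAs //; apply: (compat_at_root (bethe_simple bY r1)).
    by rewrite w dvdpZr // dvdp_mull // expr2 dvdp_mulr.
  by rewrite hornerXn expf_neq0.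
- by move=> i is1; rewrite /Z ltr_s is1.
- by move=> i si; rewrite /Z ltr_s leqNgt si.
Qed.

End FirstPass.
End GenericTuples.

(** * The Bethe ansatz equations *)

Section LogDerivativeAt.
Variable F : fieldType.
Implicit Types (p q : {poly F}) (x s : F).

(** The value s of the logarithmic derivative at x, stated without division so that products require
    no nonvanishing. *)
Definition has_dlog p x s := p^`().[x] = s * p.[x].

Lemma has_dlog1 x : has_dlog 1 x 0.
Proof. by rewrite /has_dlog -[1]/(1%:P) derivC horner0 mul0r. Qed.

Lemma has_dlogM p q x s s' : has_dlog p x s -> has_dlog q x s' -> has_dlog (p * q) x (s + s').
Proof. by rewrite /has_dlog derivM hornerD !hornerM => -> ->; ring. Qed.

Lemma has_dlog_XsubC x a : x != a -> has_dlog ('X - a%:P) x (x - a)^-1.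
Proof. by move=> xa; rewrite /has_dlog derivXsubC !hornerE mulVf // subr_eq0. Qed.

Lemma has_dlogXn n x : (n != 0%N -> x != 0) -> has_dlog 'X^n x (n%:R / x).
Proof.
case: n => [_|n /(_ isT) x0]; first by rewrite mul0r expr0; exact: has_dlog1.
by rewrite /has_dlog derivXn hornerMn !hornerXn exprS mulrA divfK // mulr_natl.
Qed.

Lemma has_dlog_prod (I : finType) (P : pred I) (a : I -> F) x :
  (forall i, P i -> x != a i) ->
  has_dlog (\prod_(i | P i) ('X - (a i)%:P)) x (\sum_(i | P i) (x - a i)^-1).
Proof.
move=> xa; elim/big_rec2: _ => [|i p s Pi]; first exact: has_dlog1.
by apply: has_dlogM; apply: has_dlog_XsubC; exact: xa.
Qed.

(** For y = (x - a_i) h, the values at a_i are y' = h and y'' = 2 h', so the expression vanishes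
    when f'/f = 2 h'/h there. The summand j = i contributes nothing because 0^-1 = 0. *)
Lemma root_compat (I : finType) (P : pred I) (a : I -> F) i f s :
  P i -> (forall j, P j -> j != i -> a i != a j) ->
  has_dlog f (a i) s -> s = (\sum_(j | P j) (a i - a j)^-1) *+ 2 ->
  root (f * (\prod_(j | P j) ('X - (a j)%:P))^`()^`() -
        f^`() * (\prod_(j | P j) ('X - (a j)%:P))^`()) (a i).
Proof.
move=> Pi inj fs sE; set y := \prod_(j | P j) _; pose h := \prod_(j | P j && (j != i)) ('X - (a j)%:P).
have yE : y = ('X - (a i)%:P) * h by rewrite /y (bigD1 i).
have hs : has_dlog h (a i) (\sum_(j | P j && (j != i)) (a i - a j)^-1).
  by apply: has_dlog_prod => j /andP[]; exact: inj.
have sE' : s = (\sum_(j | P j && (j != i)) (a i - a j)^-1) *+ 2.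
  by rewrite sE (bigD1 i) //= subrr invr0 add0r.
rewrite /root yE !derivM !derivXsubC !derivD !derivM derivXsubC.
rewrite -[1]/(1%:P) derivC; move: fs hs; rewrite /has_dlog => fs hs.
by rewrite !hornerE /= fs hs sE'; apply/eqP; ring.
Qed.

End LogDerivativeAt.

Section BetheEquations.
Variables (F : numFieldType) (r : nat) (lam : 'I_r -> nat).
Hypothesis r2 : (2 <= r)%N.
Variables (L : nat) (c : 'I_L -> 'I_r) (t : 'I_L -> F) (y : 'I_r -> {poly F}).
Hypothesis bethe : bethe_solution
   (fun s : 'I_2 => if s == ord0 then dominant_weight lam else @omega1 r)
   (fun s : 'I_2 => if s == ord0 then 0 else 1) c t.
Hypothesis repr_y : represents c t y.
Local Notation la := (at1 0%N lam).

Definition extended_tuple (i : nat) : {poly F} := if i is 0 then 'X - 1 else at1 1 y i.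
Local Notation Y := extended_tuple.

Lemma at1E (T : Type) (x0 : T) (f : 'I_r -> T) (a : 'I_r) : at1 x0 f a.+1 = f a.
Proof. by rewrite /at1 (valK a). Qed.

Lemma extended_tupleE (a : 'I_r) : Y a.+1 = \prod_(j | c j == a) ('X - (t j)%:P).
Proof. by rewrite /extended_tuple at1E; exact: repr_y. Qed.

Lemma same_color_neq i j : j != i -> c j = c i -> t i != t j.
Proof.
case: bethe => _ dist _ ji cji; apply: dist => //.
by rewrite cji /root_pairing /simple_root eqxx; case: ifP.
Qed.

Lemma adjacent_color_neq i j : (c j).+1 = c i -> t i != t j.
Proof.
case: bethe => _ dist _ cji; apply: dist.
  by apply/eqP => ji; move: cji; rewrite ji; lia.
rewrite /root_pairing /simple_root mulf_neq0 //; first by case: ifP.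
have -> : (c i == c j) = false by apply/eqP => e; move: cji; rewrite e; lia.
by rewrite cji eqxx; case: ifP.
Qed.

Lemma color_zero i : lam (c i) != 0%N -> t i != 0.
Proof.
case: bethe => neq_z _ _ li; have := neq_z i ord0; rewrite /= ?eqxx; apply.
by rewrite /root_pairing /dominant_weight mulf_neq0 //; case: ifP.
Qed.

Lemma color_one i : c i = 0%N :> nat -> t i != 1.
Proof.
case: bethe => neq_z _ _ ci; have := neq_z i (lift ord0 ord0); rewrite /=; apply.
by rewrite /root_pairing /omega1 ci eqxx mulr1; case: ifP.
Qed.

(** The Bethe equation sorted by color, and halved except for the last color. Neighbouring simple
    roots always pair to -2; the summand j = i is 0 by the convention on inverses. *)
Lemma bethe_color_equation i :
  (\sum_(j | c j == c i) (t i - t j)^-1) *+ 2 =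
  (lam (c i))%:R / t i +
  (if ((c i).+1 < r)%N then
     (if (c i : nat) == 0%N then (t i - 1)^-1
      else \sum_(j | (c j).+1 == c i) (t i - t j)^-1) +
     \sum_(j | c j == (c i).+1 :> nat) (t i - t j)^-1
   else (\sum_(j | (c j).+1 == c i) (t i - t j)^-1) *+ 2).
Proof.
case: bethe => _ _ /(_ i); rewrite 2!big_ord_recl big_ord0 addr0 /= subr0.
set S0 := \sum_(j | c j == c i) _.
set Sm := \sum_(j | (c j).+1 == c i) _.
set Sp := \sum_(j | c j == (c i).+1 :> nat) _.
have -> : \sum_(j | j != i) (root_pairing (c i) (simple_root (c j)))%:~R / (t i - t j) =
    (root_pairing (c i) (simple_root (c i)))%:~R * S0 + - 2 * Sm + - 2 * Sp.
  rewrite /S0 /Sm /Sp !mulr_sumr big_mkcond [in RHS]big_mkcond /=.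
  rewrite [X in _ + X + _]big_mkcond [X in _ + _ + X]big_mkcond -!big_split /=.
  apply: eq_bigr => j _; have [->|ji] := eqVneq j i.
    by rewrite subrr invr0 !mulr0 !if_same !addr0.
  have [cE|cN] := eqVneq (c j) (c i).
    by rewrite cE eqn_leq ltnn /= eqn_leq ltnn andbF !addr0.
  rewrite add0r /root_pairing /simple_root [c i == c j]eq_sym (negPf cN).
  rewrite [(c i : nat) == (c j).+1]eq_sym.
  have [cji|_] := eqVneq ((c j).+1) (c i : nat).
    have -> : ((c j : nat) == (c i).+1) = false by apply/eqP; lia.
    by rewrite addr0; case: ifP => _; rewrite ?mul1r.
  have [cji|_] := eqVneq (c j : nat) (c i).+1; last by rewrite mulr0 mul0r addr0.
  have -> : ((c i).+1 == r) = false by rewrite -cji ltn_eqF.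
  by rewrite add0r.
set w := (t i)^-1; set v := (t i - 1)^-1; set n : F := (lam (c i))%:R.
rewrite /root_pairing /simple_root eqxx /dominant_weight /omega1.
have two0 : (2 : F) != 0 by rewrite pnatr_eq0.
case: ltnP => cir.
  rewrite (ltn_eqF cir) !intrM -/n; case: eqP => ci0 /= eq0.
    have Sm0 : Sm = 0 by rewrite /Sm big_pred0 // => j; apply/eqP; lia.
    apply/eqP; rewrite -subr_eq0; apply/eqP; apply: (mulfI two0); rewrite mulr0 -eq0 Sm0.
    by ring.
  apply/eqP; rewrite -subr_eq0; apply/eqP; apply: (mulfI two0); rewrite mulr0 -eq0.
  by ring.
have cr : (c i).+1 = r by apply/eqP; rewrite eqn_leq ltn_ord cir.
have Sp0 : Sp = 0.
  by rewrite /Sp big_pred0 // => j; apply/eqP => cj; have := ltn_ord (c j); lia.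
have -> : ((c i : nat) == 0%N) = false by apply/eqP; lia.
rewrite cr eqxx !mul1r Sp0 /= => eq0; apply/eqP; rewrite -subr_eq0; apply/eqP.
by rewrite -eq0 -/n; ring.
Qed.

Definition color_roots (a : 'I_r) : seq F := [seq t j | j <- enum [pred j | c j == a]].

Lemma extended_tuple_roots (a : 'I_r) : Y a.+1 = \prod_(x <- color_roots a) ('X - x%:P).
Proof. by rewrite extended_tupleE big_map big_enum. Qed.

Lemma color_rootsP a x : reflect (exists2 j, c j = a & x = t j) (x \in color_roots a).
Proof.
apply: (iffP mapP) => [[j]|[j cj ->]]; first by rewrite mem_enum => /eqP; exists j.
by exists j; rewrite // mem_enum inE cj.
Qed.

Lemma color_roots_uniq a : uniq (color_roots a).
Proof.
rewrite map_inj_in_uniq ?enum_uniq // => i j; rewrite !mem_enum !inE.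
move=> /eqP ci /eqP cj tij; apply/eqP; rewrite eq_sym; apply: contraT => ji.
by have := same_color_neq ji; rewrite ci cj tij eqxx => /(_ erefl).
Qed.

Lemma has_dlog_next i : ((c i).+1 < r)%N ->
  has_dlog (Y (c i).+2) (t i) (\sum_(j | c j == (c i).+1 :> nat) (t i - t j)^-1).
Proof.
move=> ci; rewrite (extended_tupleE (Ordinal ci)); apply: has_dlog_prod => j /eqP cj.
by rewrite eq_sym; apply: adjacent_color_neq; rewrite cj.
Qed.

Lemma extended_tuple_prev i : (c i : nat) != 0%N ->
  Y (c i) = \prod_(j | (c j).+1 == c i) ('X - (t j)%:P).
Proof.
move=> c0; have cr : ((c i).-1 < r)%N by have := ltn_ord (c i); lia.
have -> : (c i : nat) = (Ordinal cr).+1 by rewrite -[nat_of_ord (Ordinal cr)]/((c i).-1); lia.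
by rewrite extended_tupleE; apply: eq_bigl => j; rewrite -val_eqE /=; lia.
Qed.

Lemma has_dlog_prev i : has_dlog (Y (c i)) (t i)
  (if (c i : nat) == 0%N then (t i - 1)^-1
   else \sum_(j | (c j).+1 == c i) (t i - t j)^-1).
Proof.
case: eqP => [c0|/eqP c0].
  by rewrite c0 /=; apply: (has_dlog_XsubC (a := 1)); exact: color_one.
rewrite extended_tuple_prev //; apply: has_dlog_prod => j /eqP cj.
exact: adjacent_color_neq.
Qed.

Lemma prev_neq0 i : (Y (c i)).[t i] != 0.
Proof.
have [c0|c0] := eqVneq (c i : nat) 0%N.
  by rewrite c0 /= -[1]/(1%:P) hornerXsubC subr_eq0; exact: color_one.
rewrite extended_tuple_prev // horner_prod; apply/prodf_neq0 => j /eqP cj.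
by rewrite hornerXsubC subr_eq0; exact: adjacent_color_neq.
Qed.

(** Each component has distinct roots, so divisibility is checked root by root, where [root_compat]
    reduces it to [bethe_color_equation]. *)
Lemma bethe_tuple_extended : bethe_tuple lam Y.
Proof.
have ordP i : (0 < i <= r)%N -> exists a : 'I_r, i = a.+1.
  by case: i => // i ir; exists (Ordinal ir).
split=> // i /ordP[a ->] {i}.
- rewrite /compat {1}extended_tuple_roots; apply: uniq_roots_dvdp; last first.
    by rewrite uniq_rootsE color_roots_uniq.
  apply/allP => x /color_rootsP[i ci ->]; rewrite extended_tupleE -ci.
  have dX : has_dlog 'X^(la (c i).+1) (t i) ((lam (c i))%:R / t i).
    by rewrite at1E; apply: has_dlogXn; exact: color_zero.
  apply: (root_compat _ _ _ (esym (bethe_color_equation i))) => //.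
    by move=> j /eqP cj ji; apply: same_color_neq.
  rewrite /neighbours succnK; apply: (has_dlogM dX); have := has_dlog_prev i.
  case: (ltnP (c i).+1 r) => cir H; first exact: (has_dlogM H (has_dlog_next cir)).
  move: H.
  have -> : ((c i : nat) == 0%N) = false by apply/eqP; have := ltn_ord (c i); lia.
  by move=> H; rewrite expr2 mulr2n; apply: has_dlogM.
- have := color_roots_uniq a; rewrite -separable_prod_XsubC -extended_tuple_roots.
  by rewrite unlock.
- rewrite succnK extended_tuple_roots big_seq.
  elim/big_ind: _ => [|p q cp cq|x /color_rootsP[i ci ->]].
  + exact: coprime1p.
  + by rewrite coprimepMl cp.
  + by rewrite coprimep_sym coprimep_XsubC -ci /root prev_neq0.
- rewrite -/(root _ _) extended_tuple_roots root_prod_XsubC at1E.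
  move=> /color_rootsP[i ci ti]; apply/eqP; apply: contraT; rewrite -ci => /color_zero.
  by rewrite -ti eqxx.
Qed.

End BetheEquations.

(** * Representations of so(2r+1) *)

(** A subspace contained in P grows one dimension at a time until it exhausts P, and dim V bounds
    the process. Inductive predicates can thus serve as submodules. *)
Lemma linear_closed_vspace (K : fieldType) (V : vectType K) (P : V -> Prop) :
  P 0 -> (forall a u v, P u -> P v -> P (a *: u + v)) ->
  exists U : {vspace V}, forall u, u \in U <-> P u.
Proof.
move=> P0 Plin.
have grow n : (exists U : {vspace V}, forall u, u \in U <-> P u) \/
    exists2 U : {vspace V}, (n <= \dim U)%N & forall u, u \in U -> P u.
  elim: n => [|n IH].
    by right; exists 0%VS => // u; rewrite memv0 => /eqP->.
  case: IH => [|[U Un UP]]; first by left.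
  case: (classic (forall u, P u -> u \in U)) => [PU|/not_all_ex_not[u]].
    by left; exists U => u; split; [exact: UP | exact: PU].
  move=> nPu; have [Pu /negP uU] := imply_to_and _ _ nPu; right; exists (U + <[u]>)%VS.
    rewrite dimv_disjoint_sum.
      rewrite dim_vline (_ : u != 0) ?addn1 //.
      by apply: contraNneq uU => ->; exact: mem0v.
    apply/eqP; rewrite -subv0; apply/subvP => w; rewrite memv_cap => /andP[wU].
    move=> /vlineP[a wE]; rewrite memv0 wE; apply: contraNT uU; rewrite scaler_eq0.
    move=> /norP[a0 _]; have := memvZ a^-1 wU.
    by rewrite wE scalerA mulVf // scale1r.
  move=> w /memv_addP[w1 w1U [w2 /vlineP[a ->] ->]].
  by rewrite addrC; apply: Plin => //; exact: UP.
case: (grow (dim V).+1) => // -[U]; rewrite ltnNge.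
by have := dimvS (subvf U); rewrite dimvf => ->.
Qed.

Lemma eigen_independent (K : numFieldType) n (A : 'M[K]_n) (c : K) N (g : nat -> 'cV[K]_n) :
  (forall k, (k < N)%N -> A *m g k = (c - k%:R) *: g k) ->
  \sum_(k < N) g k = 0 -> forall k, (k < N)%N -> g k = 0.
Proof.
elim: N g => [|N IH] g Ag sg // k kN.
have sg' : \sum_(k < N) (N%:R - k%:R) *: g k = 0.
  have : A *m (\sum_(k < N.+1) g k) - (c - N%:R) *: (\sum_(k < N.+1) g k) = 0.
    by rewrite sg mulmx0 scaler0 subr0.
  rewrite mulmx_sumr scaler_sumr -sumrB big_ord_recr /= Ag ?leqnn // subrr addr0.
  move=> E; apply: (etrans _ E); apply: eq_bigr => i _.
  rewrite (Ag _ (ltnW (ltn_ord i))) -scalerBl; congr (_ *: _); ring.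
have low j : (j < N)%N -> g j = 0.
  move=> jN; have := IH (fun k => (N%:R - k%:R) *: g k) _ sg' j jN.
  have Nj : N%:R - j%:R != 0 :> K by rewrite subr_eq0 eqr_nat gtn_eqF.
  move=> H; have /eqP : (N%:R - j%:R) *: g j = 0.
    apply: H => i iN; rewrite -scalemxAr (Ag _ (ltnW iN)) !scalerA.
    by congr (_ *: _); exact: mulrC.
  by rewrite scaler_eq0 (negPf Nj) => /eqP.
move: kN; rewrite ltnS leq_eqVlt => /orP[/eqP->|/low//].
by move: sg; rewrite big_ord_recr /= big1 ?add0r // => i _; exact: low.
Qed.

(** * The grading of so(2r+1) by superdiagonals *)

Section Grading.
Variables (F : numFieldType) (r : nat).
Local Notation M := 'M[F]_((r.*2).+1).
Local Notation so := (@so F r).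

Lemma soP (X : M) : reflect (forall i j, X (rev_ord j) i + X (rev_ord i) j = 0) (X \in so).
Proof.
have revE (i k : 'I_(r.*2).+1) : (i + k == r.*2)%N = (k == rev_ord i).
  by rewrite -val_eqE /=; have := ltn_ord i; have := ltn_ord k; lia.
have entry i j : (X^T *m @so_form F r + @so_form F r *m X) i j =
    X (rev_ord j) i + X (rev_ord i) j.
  rewrite !mxE; congr (_ + _).
    rewrite (bigD1 (rev_ord j)) //= !mxE big1 ?addr0.
      by rewrite addnC revE eqxx mulr1.
    by move=> k kj; rewrite !mxE addnC revE (negPf kj) mulr0.
  rewrite (bigD1 (rev_ord i)) //= !mxE big1 ?addr0.
    by rewrite revE eqxx mul1r.
  by move=> k ki; rewrite !mxE revE (negPf ki) mul0r.
rewrite unfold_in; apply: (iffP eqP) => [E i j|E].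
  by rewrite -entry E mxE.
by apply/matrixP => i j; rewrite entry E mxE.
Qed.

Lemma so_bracket (X Y : M) : X \in so -> Y \in so -> X *m Y - Y *m X \in so.
Proof.
have so_tr (Z : M) : Z \in so -> Z^T *m @so_form F r = - (@so_form F r *m Z).
  by rewrite unfold_in addr_eq0 => /eqP.
have tr_mul (V Z : M) : V \in so -> Z \in so ->
    (V *m Z)^T *m @so_form F r = @so_form F r *m (Z *m V).
  move=> /so_tr sV /so_tr sZ; rewrite trmx_mul -mulmxA sV mulmxN mulmxA sZ mulNmx opprK.
  by rewrite mulmxA.
move=> sX sY; rewrite unfold_in; apply/eqP.
rewrite raddfB /= mulmxBl mulmxBr (tr_mul X Y) // (tr_mul Y X) //.
by rewrite addrA subrK subrr.
Qed.

(* The (k - 2r)-th superdiagonal of X. *)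
Definition offset_part (k : nat) (X : M) : M :=
  \matrix_(i, j) (X i j *+ (j + r.*2 == i + k)%N).

Lemma offset_part_so k X : X \in so -> offset_part k X \in so.
Proof.
move=> /soP sX; apply/soP => i j; rewrite !mxE /=.
have -> : (i + r.*2 == r.*2.+1 - j.+1 + k)%N = (i + j == k)%N.
  by have := ltn_ord j; lia.
have -> : (j + r.*2 == r.*2.+1 - i.+1 + k)%N = (i + j == k)%N.
  by have := ltn_ord i; lia.
by rewrite -mulrnDl sX mul0rn.
Qed.

Lemma offset_part_sum X : X = \sum_(k < (r.*2).*2.+1) offset_part k X.
Proof.
apply/matrixP => i j; rewrite summxE.
have kP : (j + r.*2 - i < (r.*2).*2.+1)%N by have := ltn_ord j; lia.
rewrite (bigD1 (Ordinal kP)) //= big1 ?addr0.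
  rewrite mxE (_ : (_ == _) = true) //; have := ltn_ord i; lia.
move=> k; rewrite -val_eqE /= => kj; rewrite mxE (_ : (_ == _) = false) //.
by apply/negP => /eqP E; move/negP: kj; apply; apply/eqP; lia.
Qed.

Lemma offset_part_nplus k X : X \in so -> (r.*2 < k)%N -> offset_part k X \in @so_nplus F r.
Proof.
move=> sX k2; rewrite unfold_in offset_part_so //=.
apply/forallP => i; apply/forallP => j; apply/implyP => ji; rewrite mxE.
by rewrite (_ : (j + r.*2 == i + k)%N = false) ?mulr0n //; lia.
Qed.

Lemma nplus_so X : X \in @so_nplus F r -> X \in so.
Proof. by rewrite unfold_in => /andP[]. Qed.

Lemma nplusP X : X \in @so_nplus F r -> forall i j : 'I__, (j <= i)%N -> X i j = 0.
Proof.
rewrite unfold_in => /andP[_ /forallP H] i j ji.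
by have /forallP/(_ j)/implyP/(_ ji)/eqP := H i.
Qed.

Lemma nplus_offset_part X k : X \in @so_nplus F r -> (k <= r.*2)%N -> offset_part k X = 0.
Proof.
move=> nX kr; apply/matrixP => i j; rewrite !mxE.
by case: eqP => // E; rewrite (nplusP nX) ?mul0rn //; lia.
Qed.

(* The sum of the fundamental coweights; its adjoint action multiplies the
   k-th superdiagonal by k. *)
Definition height : M := \matrix_(i, j) ((r%:R - (i : nat)%:R) *+ (i == j)).

Lemma height_so : height \in so.
Proof.
apply/soP => i j; rewrite !mxE /=.
have -> : (rev_ord j == i) = (rev_ord i == j).
  by rewrite -!val_eqE /=; have := ltn_ord i; have := ltn_ord j; lia.
case: eqP => [<-|_]; last by rewrite addr0.
rewrite /= -mulrnDl mulr1n.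
have ir := ltn_ord i.
have -> : (r.*2.+1 - (r.*2.+1 - i.+1).+1 = i)%N by lia.
rewrite subSS; move: (nat_of_ord i) ir => a ar.
by rewrite natrB // -addnn natrD; ring.
Qed.

Lemma mul_height_l (X : M) i j : (height *m X) i j = (r%:R - (i : nat)%:R) * X i j.
Proof.
rewrite !mxE (bigD1 i) //= mxE eqxx big1 ?addr0 // => k ki.
by rewrite mxE eq_sym (negPf ki) mul0r.
Qed.

Lemma mul_height_r (X : M) i j : (X *m height) i j = X i j * (r%:R - (j : nat)%:R).
Proof.
rewrite !mxE (bigD1 j) //= mxE eqxx big1 ?addr0 // => k ki.
by rewrite mxE (negPf ki) mulr0.
Qed.

Lemma height_bracket k X :
  height *m offset_part k X - offset_part k X *m height =
  (k%:R - r.*2%:R) *: offset_part k X.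
Proof.
apply/matrixP => i j; rewrite mxE [X in _ + X]mxE mul_height_l mul_height_r !mxE.
case: eqP => [E|_]; last by rewrite mulr0n !mulr0 mul0r subr0.
have -> : k%:R - r.*2%:R = (j : nat)%:R - (i : nat)%:R :> F.
  apply/eqP; rewrite subr_eq addrAC eq_sym subr_eq -!natrD eqr_nat E addnC //.
by ring.
Qed.

End Grading.

(** * Submodules generated by singular vectors *)

Section Words.
Variables (F : numFieldType) (r n : nat).
Local Notation M := 'M[F]_((r.*2).+1).
Local Notation so := (@so F r).
Variable rho : {linear M -> 'M[F]_n}.
Hypothesis rhoP : so_module rho.

Lemma module_comm X Y (u : 'cV[F]_n) : X \in so -> Y \in so ->
  rho X *m (rho Y *m u) = rho Y *m (rho X *m u) + rho (X *m Y - Y *m X) *m u.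
Proof.
by move=> sX sY; rewrite rhoP // mulmxBl !mulmxA addrC subrK.
Qed.

Lemma height_offset k X (u : 'cV[F]_n) a : X \in so ->
  rho (height F r) *m u = a *: u ->
  rho (height F r) *m (rho (offset_part k X) *m u) =
  (a + (k%:R - r.*2%:R)) *: (rho (offset_part k X) *m u).
Proof.
move=> sX Hu; rewrite module_comm ?height_so ?offset_part_so // Hu height_bracket.
by rewrite -scalemxAr [rho (_ *: _)]linearZ -scalemxAl scalerDl.
Qed.

(** The part of X at offset 2r is its diagonal. A whole space B is allowed rather than a line, since
    a singular vector of given height need not be a weight vector. *)
Record singular_space (c : F) (B : 'cV[F]_n -> Prop) : Prop := SingularSpace {
  singular_lin : forall a u v, B u -> B v -> B (a *: u + v);
  singular_zero : B 0;
  singular_nplus : forall X u, X \in @so_nplus F r -> B u -> rho X *m u = 0;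
  singular_cartan : forall X u, X \in so -> B u -> B (rho (offset_part r.*2 X) *m u);
  singular_height : forall u, B u -> rho (height F r) *m u = c *: u }.

Section Span.
Variables (c : F) (B : 'cV[F]_n -> Prop).
Hypothesis sB : singular_space c B.

(** The index is the depth, the total downward shift of the letters applied; a word of depth k has
    height c - k. *)
Inductive word : nat -> 'cV[F]_n -> Prop :=
| word_nil u : B u -> word 0 u
| word_cons k d X u : (d < r.*2)%N -> X \in so -> word k u ->
    word (k + (r.*2 - d)) (rho (offset_part d X) *m u).

Inductive word_span : 'cV[F]_n -> Prop :=
| word_span0 : word_span 0
| word_spanD k u x : word k u -> word_span x -> word_span (u + x).

Lemma word_scale k u a : word k u -> word k (a *: u).
Proof.
elim=> [v Bv|{}k d X v dr sX _ IH].
  by apply: word_nil; rewrite -[_ *: _]addr0; apply: (singular_lin sB) => //; exact: (singular_zero sB).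
by rewrite scalemxAr; exact: word_cons.
Qed.

Lemma word_span_add x y : word_span x -> word_span y -> word_span (x + y).
Proof.
elim=> [|k u z wu _ IH] sy; first by rewrite add0r.
by rewrite -addrA; apply: word_spanD wu (IH sy).
Qed.

Lemma word_span_lin a x y : word_span x -> word_span y -> word_span (a *: x + y).
Proof.
move=> sx sy; apply: word_span_add => //; elim: sx => [|k u z wu _ IH].
  by rewrite scaler0; exact: word_span0.
by rewrite scalerDr; apply: (word_spanD _ IH); exact: (word_scale _ wu).
Qed.

Lemma word_span_word k u : word k u -> word_span u.
Proof. by move=> wu; rewrite -[u]addr0; apply: (word_spanD wu); exact: word_span0. Qed.

Lemma word_span_lower d X x : (d < r.*2)%N -> X \in so -> word_span x ->
  word_span (rho (offset_part d X) *m x).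
Proof.
move=> dr sX; elim=> [|k u z wu _ IH]; first by rewrite mulmx0; exact: word_span0.
by rewrite mulmxDr; apply: (word_spanD _ IH); exact: (word_cons dr sX wu).
Qed.

(** For the empty word X is split into diagonals; otherwise X is commuted past the leftmost letter,
    and the bracket is again in so. Hence lowering words alone span the generated submodule. *)
Lemma word_stable k u : word k u -> forall X, X \in so -> word_span (rho X *m u).
Proof.
elim=> [{k} v Bv X sX|{}k d Y v dr sY _ IH X sX].
  rewrite [X]offset_part_sum linear_sum mulmx_suml.
  elim/big_ind: _ => [|x y|d _]; [exact: word_span0|exact: word_span_add|].
  case: (ltngtP d r.*2) => [dr|dr|->].
  - by apply: word_span_lower => //; apply: (word_span_word (word_nil Bv)).
  - rewrite (singular_nplus sB (offset_part_nplus sX dr) Bv); exact: word_span0.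
  - exact: (word_span_word (word_nil (singular_cartan sB sX Bv))).
rewrite module_comm ?offset_part_so //; apply: word_span_add.
  by apply: word_span_lower => //; exact: IH.
by apply: IH; apply: so_bracket => //; exact: offset_part_so.
Qed.

Lemma word_span_stable X x : X \in so -> word_span x -> word_span (rho X *m x).
Proof.
move=> sX; elim=> [|k u z wu _ IH]; first by rewrite mulmx0; exact: word_span0.
by rewrite mulmxDr; apply: word_span_add => //; exact: (word_stable wu).
Qed.

Lemma word_height k u : word k u -> rho (height F r) *m u = (c - k%:R) *: u.
Proof.
elim=> [v Bv|{}k d X v dr sX _ IH]; first by rewrite subr0; exact: (singular_height sB).
rewrite (height_offset _ sX IH); congr (_ *: _).
by rewrite natrD natrB ?(ltnW dr) //; ring.
Qed.

Lemma word0_inv k u : word k u -> k = 0%N -> B u.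
Proof. by case=> // {}k d X v dr _ _ k0; exfalso; lia. Qed.

Lemma word_span_graded x : word_span x -> exists N (g : nat -> 'cV[F]_n),
  [/\ x = \sum_(k < N) g k,
      forall k, rho (height F r) *m g k = (c - k%:R) *: g k,
      B (g 0%N) & forall k, (N <= k)%N -> g k = 0].
Proof.
elim=> [|k u z wu _ [N [g [zE gH gB gN]]]].
  exists 0%N, (fun=> 0); split=> //; first by rewrite big_ord0.
    by move=> k; rewrite mulmx0 scaler0.
  exact: (singular_zero sB).
exists (maxn N k.+1), (fun j => (if j == k then u else 0) + g j); split.
- rewrite big_split /=; congr (_ + _).
    have kN : (k < maxn N k.+1)%N by rewrite leq_max leqnn orbT.
    rewrite (bigD1 (Ordinal kN)) //= eqxx big1 ?addr0 // => j.
    by rewrite -val_eqE /= => /negPf->.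
  rewrite zE (big_ord_widen (maxn N k.+1) g) ?leq_maxl // big_mkcond.
  by apply: eq_bigr => j _; case: ltnP => // /gN->.
- move=> j; rewrite mulmxDr scalerDr gH; congr (_ + _).
  by case: eqP => [->|_]; [exact: word_height | rewrite mulmx0 scaler0].
- rewrite -[X in B (X + _)]scale1r; apply: (singular_lin sB) => //.
  by case: eqP => [k0|_]; [exact: (word0_inv wu) | exact: (singular_zero sB)].
- move=> j; rewrite geq_max => /andP[Nj kj]; rewrite gN // addr0.
  by rewrite gtn_eqF.
Qed.

(** Height components are independent, so those of an eigenvector vanish except at one depth. In
    particular height c occurs only in B. *)
Lemma word_span_eigen x e : word_span x -> rho (height F r) *m x = e *: x ->
  x != 0 -> exists2 k : nat, e = c - k%:R & (k = 0%N -> B x).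
Proof.
move=> /word_span_graded[N [g [xE gH gB gN]]] Hx x0.
have sg : \sum_(k < N) ((c - k%:R - e) *: g k) = 0.
  have : rho (height F r) *m x - e *: x = 0 by rewrite Hx subrr.
  rewrite xE mulmx_sumr scaler_sumr -sumrB => E; apply: (etrans _ E).
  by apply: eq_bigr => k _; rewrite gH -scalerBl.
have gk k : (k < N)%N -> (c - k%:R - e) *: g k = 0.
  apply: (@eigen_independent F n (rho (height F r)) c N
    (fun k => (c - k%:R - e) *: g k) _ sg).
  by move=> j _; rewrite -scalemxAr gH !scalerA; congr (_ *: _); exact: mulrC.
case: (classic (exists k, (k < N)%N /\ g k <> 0)) => [[k [kN gk0]]|none].
  have eE : e = c - k%:R.
    have /eqP := gk k kN; rewrite scaler_eq0 => /orP[|/eqP//].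
    by rewrite subr_eq0 => /eqP.
  exists k => // k0; rewrite xE (bigD1 (Ordinal kN)) //= big1 ?addr0 ?k0 //.
  move=> j; rewrite -val_eqE /= k0 => j0; have /eqP := gk j (ltn_ord j).
  rewrite scaler_eq0 => /orP[|/eqP//]; rewrite eE k0 subr0 addrAC subrr sub0r.
  by rewrite oppr_eq0 pnatr_eq0 (negPf j0).
case/eqP: x0; rewrite xE big1 // => k _; apply/eqP/negPn/negP => /eqP gk0.
by apply: none; exists k.
Qed.

End Span.
End Words.

(** * The Cartan subalgebra in the basis dual to the eps_i *)

Section Cartan.
Variables (F : numFieldType) (r : nat).
Local Notation M := 'M[F]_((r.*2).+1).
Local Notation so := (@so F r).
Local Notation h := (@cartan_basis F r).

(* f i is the i-th coordinate of mu in the basis eps_1, ..., eps_r (numbered from 0). *)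
Definition eps_coords (mu : weight r) (f : nat -> F) : Prop :=
  forall i : 'I_r, if i.+1 == r then f i *+ 2 = (mu i)%:~R
                   else f i - f i.+1 = (mu i)%:~R.

Lemma eps_coords_exists mu : exists f, eps_coords mu f.
Proof.
pose f i : F := \sum_(j < r | (i <= j)%N) (mu j)%:~R / (if j.+1 == r then 2 else 1).
exists f => i; case: eqP => ir.
  rewrite /f (bigD1 i) //= big1 ?addr0; last first.
    move=> j /andP[ij]; rewrite -val_eqE /= => ji; have := ltn_ord j; lia.
  by rewrite ir eqxx -[_ / _ *+ 2]mulr_natr divfK // pnatr_eq0.
rewrite /f (bigD1 i) //= (introF eqP ir) divr1 [X in _ - X](eq_bigl (fun j : 'I_r => (i <= j)%N && (j != i))).
  by rewrite addrK.
by move=> j; rewrite -val_eqE /=; lia.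
Qed.

(** Solved downwards from the last index, whose coroot is twice the basis element; each earlier
    coroot is h_i - h_(i+1). *)
Lemma cartan_eigen (V : lmodType F) (Phi : M -> V) mu f w :
  (forall a X Y, Phi (a *: X + Y) = a *: Phi X + Phi Y) -> eps_coords mu f ->
  (forall i, Phi (coroot F i) = (mu i)%:~R *: w) ->
  forall i, (i < r)%N -> Phi (h i) = f i *: w.
Proof.
move=> Plin cf Pc i ir.
have PhiD X Y : Phi (X + Y) = Phi X + Phi Y by have := Plin 1 X Y; rewrite !scale1r.
have PhiB X Y : Phi (X - Y) = Phi X - Phi Y.
  have -> : X - Y = (-1) *: Y + X by rewrite scaleN1r addrC.
  by rewrite Plin scaleN1r addrC.
have [d rE] : exists d, r = (i + d).+1 by exists (r - i.+1)%N; lia.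
elim: d i ir rE => [|d IH] i ir rE.
  have := cf (Ordinal ir); have := Pc (Ordinal ir).
  have ie : i.+1 == r by rewrite rE addn0.
  rewrite /coroot /= ie mulr2n PhiD => E fE.
  have two0 : (2 : F) != 0 by rewrite pnatr_eq0.
  by apply: (scalerI two0); rewrite scalerA mulr_natl fE -E scaler_nat mulr2n.
have ir1 : (i.+1 < r)%N by lia.
have := cf (Ordinal ir); have := Pc (Ordinal ir); rewrite /coroot /=.
rewrite (ltn_eqF ir1) PhiB (IH i.+1) //; last by lia.
by move=> /eqP; rewrite subr_eq => /eqP -> <-; rewrite -scalerDl subrK.
Qed.

Lemma cartan_so i : (i <= r.*2)%N -> h i \in so.
Proof.
move=> ir; apply/soP => j k; rewrite /cartan_basis !mxE.
set a : 'I_(r.*2).+1 := inord i; set b : 'I_(r.*2).+1 := inord _.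
have ab : rev_ord a = b.
  by apply: val_inj; rewrite /= !inordK //; lia.
have revE (x y : 'I_(r.*2).+1) : (rev_ord x == y) = (x == rev_ord y).
  by rewrite -(inj_eq rev_ord_inj) rev_ordK.
by rewrite !revE ab -ab rev_ordK; do 4!case: (_ == _); rewrite /=; ring.
Qed.

Lemma offset_part_diag X : X \in so ->
  offset_part r.*2 X = \sum_(i < r) X (inord i) (inord i) *: h i.
Proof.
move=> /soP sX; apply/matrixP => a b; rewrite summxE mxE.
have antisym (p : 'I_(r.*2).+1) : X (rev_ord p) (rev_ord p) = - X p p.
  by apply/eqP; rewrite -addr_eq0 -{3}(rev_ordK p); apply/eqP; apply: sX.
have sub_inord (i : 'I_r) : rev_ord (inord i : 'I_(r.*2).+1) = inord (r.*2 - i).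
  by have il := ltn_ord i; apply: val_inj; rewrite /= !inordK //; lia.
have [<-|ab] := eqVneq a b; last first.
  have -> : (b + r.*2 == a + r.*2)%N = false.
    by rewrite eqn_add2r; apply/negP => /eqP/val_inj E; rewrite E eqxx in ab.
  rewrite mulr0n big1 // => i _; rewrite !mxE.
  have ne c : (a == c) && (b == c) = false.
    by apply/negP => /andP[/eqP E1 /eqP E2]; rewrite E1 E2 eqxx in ab.
  by rewrite !ne subr0 mulr0.
rewrite eqxx mulr1n; have aord := ltn_ord a.
have termE (i : 'I_r) : (X (inord i) (inord i) *: h i) a a =
   X (inord i) (inord i) * ((a == inord i)%:R - (rev_ord a == inord i)%:R).
  rewrite !mxE !andbb -sub_inord; congr (_ * (_ - _%:R)).
  by rewrite -(inj_eq rev_ord_inj) rev_ordK.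
rewrite (eq_bigr _ (fun i _ => termE i)).
have inordE (p : 'I_(r.*2).+1) (i : nat) : (i < r)%N -> (p == inord i) = (p == i :> nat).
  by move=> ilt; rewrite -val_eqE /= inordK //; lia.
case: (ltngtP a r) => [ar|ra|ar].
- rewrite (bigD1 (Ordinal ar)) //= big1 ?addr0.
    rewrite !inordE //= eqxx (_ : (_ == _) = false) ?subr0 ?mulr1; last by lia.
    by have -> : inord a = a by apply: val_inj; rewrite /= inordK.
  move=> i; rewrite -val_eqE /= => ia; rewrite !inordE //= eq_sym (negPf ia).
  by rewrite (_ : (_ == _) = false) ?subrr ?mulr0 //; have := ltn_ord i; lia.
- have ar' : (r.*2 - a < r)%N by lia.
  rewrite (bigD1 (Ordinal ar')) //= big1 ?addr0.
    rewrite !inordE //= (_ : (_ == _) = false); last by lia.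
    rewrite subSS eqxx sub0r mulrN1.
    have -> : inord (r.*2 - a) = rev_ord a by apply: val_inj; rewrite /= inordK //; lia.
    by rewrite antisym opprK.
  move=> i; rewrite -val_eqE /= => ia; rewrite !inordE //= subSS eq_sym.
  rewrite (_ : (_ == _) = false); last by have := ltn_ord i; lia.
  by rewrite [_ == i :> nat]eq_sym (negPf ia) subrr mulr0.
rewrite big1; last first.
  move=> i _; rewrite !inordE //= (_ : (_ == _) = false); last by have := ltn_ord i; lia.
  by rewrite (_ : (_ == _) = false) ?subrr ?mulr0 //; have := ltn_ord i; lia.
have ra : rev_ord a = a by apply: val_inj; rewrite /=; lia.
by have /eqP := antisym a; rewrite ra -addr_eq0 -mulr2n mulrn_eq0 => /eqP.
Qed.

End Cartan.

(** * Singular vectors of simple modules *)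

Section HighestWeight.
Variables (F : numFieldType) (r n : nat).
Local Notation M := 'M[F]_((r.*2).+1).
Local Notation so := (@so F r).
Variable rho : {linear M -> 'M[F]_n}.
Hypothesis rhoP : so_module rho.

Definition line (v u : 'cV[F]_n) : Prop := exists a : F, u = a *: v.

Lemma simple_pred (P : 'cV[F]_n -> Prop) : so_simple rho -> P 0 ->
  (forall a u v, P u -> P v -> P (a *: u + v)) ->
  (forall X u, X \in so -> P u -> P (rho X *m u)) ->
  forall v, v != 0 -> P v -> forall u, P u.
Proof.
move=> simp P0 Plin Pst v v0 Pv u; have [U UP] := linear_closed_vspace P0 Plin.
apply/UP; have [||->] := simp U; last by rewrite memvf.
  by move=> X w sX /UP wU; apply/UP/Pst.
by move=> U0; move/UP: Pv; rewrite U0 memv0 (negPf v0).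
Qed.

Lemma hw_cartan (v : 'cV[F]_n) (mu : weight r) f : eps_coords mu f ->
  (forall i, rho (coroot F i) *m v = (mu i)%:~R *: v) ->
  forall i, (i < r)%N -> rho (cartan_basis F r i) *m v = f i *: v.
Proof.
move=> cf cv; apply: (cartan_eigen (Phi := fun X => rho X *m v)) cf cv.
by move=> a X Y; rewrite linearP mulmxDl scalemxAl.
Qed.

Lemma hw_singular (v : 'cV[F]_n) (mu : weight r) :
  (forall X, X \in @so_nplus F r -> rho X *m v = 0) ->
  (forall i, rho (coroot F i) *m v = (mu i)%:~R *: v) ->
  exists c, singular_space rho c (line v).
Proof.
move=> nv cv; have [f cf] := eps_coords_exists F mu; have hv := hw_cartan cf cv.
pose ev (X : M) := \sum_(i < r) X (inord i) (inord i) * f i.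
have diag X : X \in so -> rho (offset_part r.*2 X) *m v = ev X *: v.
  move=> sX; rewrite offset_part_diag // linear_sum mulmx_suml scaler_suml.
  by apply: eq_bigr => i _; rewrite linearZ -scalemxAl hv // scalerA.
exists (ev (height F r)); split.
- by move=> a _ _ [b ->] [b' ->]; exists (a * b + b'); rewrite scalerDl scalerA.
- by exists 0; rewrite scale0r.
- by move=> X _ nX [a ->]; rewrite -scalemxAr nv // scaler0.
- by move=> X _ sX [a ->]; exists (a * ev X); rewrite -scalemxAr diag // scalerA.
- move=> _ [a ->]; rewrite -scalemxAr; have := diag _ (height_so F r).
  have -> : offset_part r.*2 (height F r) = height F r.
    apply/matrixP => i j; rewrite !mxE eqn_add2r; case: (eqVneq i j) => [->|ij].
      by rewrite eqxx.
    by rewrite !mulr0n mul0rn.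
  by move=> ->; rewrite !scalerA mulrC.
Qed.

Lemma simple_word_span c B v : so_simple rho -> singular_space rho c B -> v != 0 -> B v ->
  forall u, word_span rho B u.
Proof.
move=> simp sB v0 Bv; apply: (simple_pred simp) v0 _.
- exact: word_span0.
- exact: word_span_lin sB.
- by move=> X u sX; exact: (word_span_stable rhoP sB).
- exact: (word_span_word (word_nil _ Bv)).
Qed.

(** Each height component of x is singular. A nonzero one of depth k > 0 would generate the whole
    module, with heights c - k - k' only, although v has height c. *)
Lemma singular_line c v x : so_simple rho -> singular_space rho c (line v) -> v != 0 ->
  (forall X, X \in @so_nplus F r -> rho X *m x = 0) -> line v x.
Proof.
move=> simp sv v0 nx.
have lv : line v v by exists 1; rewrite scale1r.
have [N [g [xE gH g0 gN]]] := word_span_graded rhoP sv (simple_word_span simp sv v0 lv x).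
have gn X k : X \in @so_nplus F r -> rho X *m g k = 0.
  move=> nX; case: (ltnP k N) => [kN|/gN->]; last by rewrite mulmx0.
  rewrite [X]offset_part_sum linear_sum mulmx_suml big1 // => d _.
  case: (leqP d r.*2) => [dr|dr].
    by rewrite nplus_offset_part // linear0 mul0mx.
  have nXd := offset_part_nplus (nplus_so nX) dr.
  (* A single diagonal of X sends the g_k to vectors of distinct heights, whose sum is 0. *)
  apply: (@eigen_independent F n (rho (height F r)) (c + (d%:R - r.*2%:R)) N
     (fun k => rho (offset_part d X) *m g k)) kN => [j _|].
    rewrite (height_offset rhoP _ (nplus_so nX) (gH j)); congr (_ *: _); ring.
  by rewrite -mulmx_sumr -xE nx.
have gk k : k != 0%N -> g k = 0.
  move=> k0; pose B' (z : 'cV[F]_n) := (forall X, X \in @so_nplus F r -> rho X *m z = 0) /\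
    rho (height F r) *m z = (c - k%:R) *: z.
  have sB' : singular_space rho (c - k%:R) B'.
    split.
    - move=> a z1 z2 [n1 h1] [n2 h2]; split=> [X nX|].
        by rewrite mulmxDr -scalemxAr n1 // n2 // scaler0 addr0.
      by rewrite mulmxDr -scalemxAr h1 h2 scalerDr !scalerA mulrC.
    - by split=> [X _|]; rewrite mulmx0 ?scaler0.
    - by move=> X z nX [nz _]; exact: nz.
    - move=> X z sX [nz hz]; split=> [Y nY|].
        have sY := nplus_so nY; have sD := offset_part_so r.*2 sX.
        rewrite module_comm // nz // mulmx0 add0r nz //.
        rewrite unfold_in so_bracket //=; apply/forallP => i; apply/forallP => j.
        apply/implyP => ji; apply/eqP; rewrite mxE [X in _ + X]mxE.
        have dg p q : (p != q) -> offset_part r.*2 X p q = 0.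
          by move=> pq; rewrite mxE eqn_add2r val_eqE eq_sym (negPf pq).
        have sYD : (Y *m offset_part r.*2 X) i j = 0.
          rewrite mxE big1 // => p _; have [->|pj] := eqVneq p j.
            by rewrite (nplusP nY) ?mul0r.
          by rewrite dg // mulr0.
        have sDY : (offset_part r.*2 X *m Y) i j = 0.
          rewrite mxE big1 // => p _; have [<-|pi] := eqVneq i p.
            by rewrite (nplusP nY) ?mulr0.
          by rewrite dg // mul0r.
        by rewrite sYD sDY subr0.
      rewrite (height_offset rhoP _ sX hz); congr (_ *: _); ring.
    - by move=> z [].
  apply/eqP; apply: contraT => gk0.
  have Bgk : B' (g k) by split=> // X nX; exact: gn.
  have Hv := singular_height sv lv.
  have [k' /eqP cE _] := word_span_eigen rhoP sB' (simple_word_span simp sB' gk0 Bgk v) Hv v0.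
  move: cE; rewrite -subr_eq0 !opprD !opprK !addrA subrr add0r -natrD pnatr_eq0.
  by rewrite addn_eq0 (negPf k0).
case: N xE gN => [|N] xE gN; first by rewrite xE big_ord0; exact: (singular_zero sv).
by rewrite xE big_ord_recl big1 ?addr0 // => i _; exact: gk.
Qed.

End HighestWeight.

(** * Relations of the Cartan subalgebra on V_omega1 *)

Section VectorRepresentation.
Variables (F : numFieldType) (r : nat).
Hypothesis r2 : (2 <= r)%N.
Local Notation M := 'M[F]_((r.*2).+1).
Local Notation so := (@so F r).
Local Notation h := (@cartan_basis F r).

Lemma inord_neq (i j : nat) : (i <= r.*2)%N -> (j <= r.*2)%N -> i != j ->
  (inord i == inord j :> 'I_(r.*2).+1) = false.
Proof. by move=> ir jr ij; rewrite -val_eqE /= !inordK //; apply/negbTE. Qed.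

Lemma cartan_basis_mul i j : (i < r)%N -> (j < r)%N -> i != j -> h i *m h j = 0.
Proof.
move=> ir jr ij; rewrite /cartan_basis mulmxBl !mulmxBr !mul_delta_mx_cond.
by rewrite !inord_neq ?mulr0n ?subrr //; lia.
Qed.

Lemma cartan_basis_cube i : (i < r)%N -> h i *m (h i *m h i) = h i.
Proof.
move=> ir; rewrite /cartan_basis !(mulmxBl, mulmxBr, mul_delta_mx_cond).
rewrite !eqxx !mulr1n !(@inord_neq i (r.*2 - i)) ?(@inord_neq (r.*2 - i) i); try lia.
by rewrite !mulr0n !mulmx0 !mul_delta_mx_cond !eqxx !(@inord_neq i (r.*2 - i)) ?(@inord_neq (r.*2 - i) i); try lia; rewrite !mulr0n !mulr1n !subr0 !sub0r ?opprK.
Qed.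

Definition first_vector : 'cV[F]_(r.*2).+1 := delta_mx (inord 0) 0.

Lemma cartan_first_vector i : (i <= r)%N -> h i *m first_vector = (i == 0%N)%:R *: first_vector.
Proof.
move=> ir; rewrite /cartan_basis /first_vector mulmxBl !mul_delta_mx_cond.
rewrite [inord (r.*2 - i) == _]inord_neq ?mulr0n ?subr0; try lia.
case: (eqVneq i 0%N) => [->|i0]; first by rewrite eqxx scale1r.
by rewrite inord_neq ?scale0r; try lia.
Qed.

Lemma nplus_first_vector X : X \in @so_nplus F r -> X *m first_vector = 0.
Proof.
move=> nX; apply/matrixP => i j; rewrite mxE [RHS]mxE big1 // => k _.
rewrite !mxE; case: eqP => [->|_]; last by rewrite mulr0.
by rewrite (nplusP nX) ?mul0r // inordK.
Qed.

Lemma coroot_first_vector i :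
  coroot F i *m first_vector = (@omega1 r i)%:~R *: first_vector.
Proof.
have ir := ltn_ord i; rewrite /coroot /omega1; case: eqP => ie.
  rewrite mulr2n mulmxDl !cartan_first_vector; try lia.
  by rewrite (_ : ((i : nat) == 0%N) = false) ?scale0r ?addr0 //; lia.
rewrite mulmxBl !cartan_first_vector; try lia.
by rewrite scale0r subr0.
Qed.

Section DirectSum.
Variables (m : nat) (sigma : {linear M -> 'M[F]_m}).

Definition sum_action (X : M) : 'M[F]_(m + (r.*2).+1) := block_mx (sigma X) 0 0 X.

Lemma sum_action_linear : linear sum_action.
Proof.
move=> a X Y; rewrite /sum_action scale_block_mx add_block_mx !scaler0 !addr0.
by rewrite linearP.
Qed.

HB.instance Definition _ :=
  GRing.isLinear.Build F M 'M[F]_(m + (r.*2).+1) _ sum_action sum_action_linear.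

Lemma sum_action_module : so_module sigma -> so_module sum_action.
Proof.
move=> sP X Y sX sY; rewrite /sum_action /= !mulmx_block !mulmx0 !mul0mx !addr0 !add0r.
rewrite opp_block_mx add_block_mx !subrr.
by rewrite -[LHS]/(block_mx (sigma (X *m Y - Y *m X)) 0 0 _) sP.
Qed.

Lemma mul_sum_action X (u : 'cV[F]_m) (v : 'cV[F]_(r.*2).+1) : sum_action X *m col_mx u v = col_mx (sigma X *m u) (X *m v).
Proof. by rewrite mul_block_col !mul0mx addr0 add0r. Qed.

(* sigma is a quotient of the submodule generated by (v, e_1), on which the
   projection to the vector representation is injective. *)
Lemma vector_rep_annihilated : is_irrep (@omega1 r) sigma ->
  exists S : 'cV[F]_(m + (r.*2).+1) -> Prop,
  [/\ forall X z, X \in so -> S z -> S (sum_action X *m z),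
      forall a y z, S y -> S z -> S (a *: y + z),
      forall x, exists y, S (col_mx x y) &
      forall x, S (col_mx x 0) -> x = 0].
Proof.
case=> sP simp [v v0 [nv cv]]; have dP := sum_action_module sP.
pose w := col_mx v first_vector.
have [||c sw] := @hw_singular F r _ sum_action w (@omega1 r).
- by move=> X nX; rewrite /= mul_sum_action nv // nplus_first_vector // col_mx0.
- by move=> i; rewrite /= mul_sum_action cv coroot_first_vector scale_col_mx.
have [c' sv] := hw_singular nv cv.
pose S := word_span sum_action (line w).
have S0 : S 0 by exact: word_span0.
have Slin a y z : S y -> S z -> S (a *: y + z) by exact: (word_span_lin sw).
have Sst X z : X \in so -> S z -> S (sum_action X *m z).
  by move=> sX; exact: (word_span_stable dP sw).
have Sw : S w by apply/word_span_word/word_nil; exists 1; rewrite scale1r.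
have proj x : exists y, S (col_mx x y).
  apply: (simple_pred (P := fun x => exists y, S (col_mx x y)) simp) v0 _ x.
  - by exists 0; rewrite col_mx0.
  - move=> a x1 x2 [y1 s1] [y2 s2]; exists (a *: y1 + y2).
    by rewrite -add_col_mx -scale_col_mx; exact: Slin.
  - by move=> X x sX [y sy]; exists (X *m y); rewrite -mul_sum_action; exact: Sst.
  - by exists first_vector.
exists S; split=> // x Sx; apply/eqP; apply: contraT => x0; exfalso.
(* Simplicity of sigma puts (v, 0) in S. It has the height of the generator w, so it lies on the
   line of w = (v, e_1), which is absurd. *)
have Sv : S (col_mx v 0).
  apply: (simple_pred (P := fun x => S (col_mx x 0)) simp _ _ _ x0 Sx).
  - by rewrite col_mx0.
  - by move=> a x1 x2 s1 s2; have := Slin a _ _ s1 s2; rewrite scale_col_mx add_col_mx scaler0 addr0.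
  - by move=> X z sX sz; have := Sst X _ sX sz; rewrite mul_sum_action mulmx0.
have Hw : sum_action (height F r) *m w = c *: w.
  by apply: (singular_height sw); exists 1; rewrite scale1r.
have Hv : sigma (height F r) *m v = c *: v.
  by move: Hw; rewrite mul_sum_action scale_col_mx => /eq_col_mx[].
have vn0 : col_mx v 0 != 0 :> 'cV[F]_(m + (r.*2).+1).
  apply: contra v0 => /eqP v00.
  by have /eq_col_mx[->] : col_mx v 0 = col_mx 0 0 :> 'cV[F]_(m + (r.*2).+1) by rewrite v00 col_mx0.
have Hv0 : sum_action (height F r) *m col_mx v 0 = c *: col_mx v 0.
  by rewrite mul_sum_action mulmx0 scale_col_mx scaler0 Hv.
have [k /eqP kE] := word_span_eigen dP sw Sv Hv0 vn0.
have k0 : k = 0%N.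
  move: kE; rewrite -subr_eq0 opprB addrC subrK pnatr_eq0.
  by move/eqP.
move=> /(_ k0)[a]; rewrite scale_col_mx => /eq_col_mx[vE /esym/eqP].
rewrite scaler_eq0 => /orP[/eqP a0|].
  by move: v0; rewrite vE a0 scale0r eqxx.
move=> /eqP/matrixP/(_ (inord 0) 0); rewrite !mxE !eqxx => /eqP.
by rewrite oner_eq0.
Qed.

(** The relations hold for the matrices h_i themselves. Applied to some (x, y) in S they produce an
    element of S with second component 0, whose first component is then 0. *)
Lemma irrep_omega1_cartan : is_irrep (@omega1 r) sigma ->
  (forall i, (i < r)%N -> sigma (h i) *m (sigma (h i) *m sigma (h i)) = sigma (h i)) /\
  (forall i j, (i < r)%N -> (j < r)%N -> i != j -> sigma (h i) *m sigma (h j) = 0).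
Proof.
move=> irr; have [S [Sst Slin Sproj Sinj]] := vector_rep_annihilated irr.
have hso i : (i < r)%N -> h i \in so by move=> ir; apply: cartan_so; lia.
have mx_ext (A B : 'M[F]_m) : (forall x : 'cV[F]_m, A *m x = B *m x) -> A = B.
  move=> AB; apply/matrixP => i j; have := AB (delta_mx j 0); rewrite -!colE.
  by move/matrixP/(_ i 0); rewrite !mxE.
split=> [i ir|i j ir jr ij]; apply: mx_ext => x; have [y Sxy] := Sproj x.
  have S1 := Sst _ _ (hso i ir) Sxy.
  have S3 := Sst _ _ (hso i ir) (Sst _ _ (hso i ir) S1).
  apply/eqP; rewrite -subr_eq0; apply/eqP/Sinj.
  have := Slin (-1) _ _ S1 S3; rewrite !mul_sum_action scale_col_mx add_col_mx.
  rewrite !scaleN1r !mulmxA -[h i *m h i *m h i]mulmxA cartan_basis_cube // addNr.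
  by rewrite addrC.
apply/eqP; rewrite mul0mx; apply/eqP/Sinj.
have := Sst _ _ (hso i ir) (Sst _ _ (hso j jr) Sxy).
by rewrite !mul_sum_action !mulmxA cartan_basis_mul // mul0mx.
Qed.

End DirectSum.
End VectorRepresentation.

(** * Weights of summands of the tensor product with V_omega1 *)

Section Tensor.
Variables (F : numFieldType) (r : nat).
Hypothesis r2 : (2 <= r)%N.
Local Notation M := 'M[F]_((r.*2).+1).
Local Notation so := (@so F r).
Local Notation h := (@cartan_basis F r).

(* A vector of the tensor product seen as a linear map from the dual of the
   second factor to the first one. *)
Definition tensor_mx n m (w : 'cV[F]_(n * m)) : 'M[F]_(n, m) :=
  \matrix_(i, j) w (mxtens_index (i, j)) 0.

Lemma tensor_mx_lin n m a (w w' : 'cV[F]_(n * m)) :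
  tensor_mx (a *: w + w') = a *: tensor_mx w + tensor_mx w'.
Proof. by apply/matrixP => i j; rewrite !mxE. Qed.

Lemma tensor_mx_inj n m (w : 'cV[F]_(n * m)) : tensor_mx w = 0 -> w = 0.
Proof.
move=> /matrixP E; apply/matrixP => k j; rewrite ord1.
by case: (mxtens_indexP k) => i i'; have := E i i'; rewrite !mxE.
Qed.

Lemma tensor_mx_mul n m (P : 'M[F]_n) (Q : 'M[F]_m) (w : 'cV[F]_(n * m)) :
  tensor_mx (tensmx P Q *m w) = P *m tensor_mx w *m Q^T.
Proof.
apply/matrixP => i j; rewrite !mxE.
have -> : \sum_k tensmx P Q (mxtens_index (i, j)) k * w k 0 =
    \sum_k \sum_l P i k * Q j l * w (mxtens_index (k, l)) 0.
  rewrite pair_bigA /= (reindex (@mxtens_index n m)) /=.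
    by apply: eq_bigr => -[k l] _; rewrite tensmxE.
  exists (@mxtens_unindex n m) => k _; [exact: mxtens_indexK | exact: mxtens_unindexK].
rewrite exchange_big; apply: eq_bigr => l _; rewrite !mxE mulr_suml.
by apply: eq_bigr => k _; rewrite !mxE mulrAC.
Qed.

Lemma tensor_mx_action n m (rho : {linear M -> 'M[F]_n}) (sigma : {linear M -> 'M[F]_m})
    X w :
  tensor_mx (tensor_action rho sigma X *m w) =
  rho X *m tensor_mx w + tensor_mx w *m (sigma X)^T.
Proof.
rewrite /tensor_action mulmxDl -[X in tensor_mx (X + _)]scale1r tensor_mx_lin scale1r.
by rewrite !tensor_mx_mul trmx1 mulmx1 mul1mx.
Qed.

Lemma nplus_part_neq0 n (rho : {linear M -> 'M[F]_n}) X (x : 'cV[F]_n) :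
  X \in @so_nplus F r -> rho X *m x != 0 ->
  exists2 d, (r.*2 < d)%N & rho (offset_part d X) *m x != 0.
Proof.
move=> nX; rewrite {1}[X]offset_part_sum linear_sum mulmx_suml => nz.
apply: NNPP => none; case/eqP: nz; rewrite big1 // => d _.
case: (leqP d r.*2) => [dr|dr]; first by rewrite nplus_offset_part // linear0 mul0mx.
by apply/eqP/negPn/negP => nz; apply: none; exists d.
Qed.

(** While x is not singular, some superdiagonal part of an element of n+ does not kill it. Applying
    this part shortens the list of height components, because heights above c do not occur. *)
Lemma nplus_invariant_singular n (rho : {linear M -> 'M[F]_n}) c B
    (I : 'cV[F]_n -> Prop) x :
  so_module rho -> singular_space rho c B -> (forall u, word_span rho B u) ->
  (forall X u, X \in @so_nplus F r -> I u -> I (rho X *m u)) -> I x -> x != 0 ->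
  exists y, [/\ I y, y != 0 & forall X, X \in @so_nplus F r -> rho X *m y = 0].
Proof.
move=> rhoP sB spanB Ist Ix x0.
have [N [g [xE gH _ _]]] := word_span_graded rhoP sB (spanB x).
elim/ltn_ind: N g x Ix x0 xE gH => N IH g x Ix x0 xE gH.
case: (classic (forall X, X \in @so_nplus F r -> rho X *m x = 0)) => [nx|].
  by exists x; split.
move=> /not_all_ex_not[X nX']; have [nX /eqP Xx] := imply_to_and _ _ nX'.
have [d dr Xdx] := nplus_part_neq0 nX Xx; pose e := (d - r.*2)%N.
have sX := nplus_so nX; pose g' k := rho (offset_part d X) *m g (k + e)%N.
have e0 : (0 < e)%N by rewrite subn_gt0.
have hE k : rho (height F r) *m (rho (offset_part d X) *m g k) =
    (c - k%:R + e%:R) *: (rho (offset_part d X) *m g k).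
  by rewrite (height_offset rhoP _ sX (gH k)) /e natrB // ltnW.
have low k : (k < e)%N -> rho (offset_part d X) *m g k = 0.
  move=> ke; apply/eqP; apply: contraT => nz.
  have [k' /eqP kE _] := word_span_eigen rhoP sB (spanB _) (hE k) nz.
  have : (e + k')%:R == k%:R :> F.
    rewrite natrD -subr_eq0.
    have -> : e%:R + k'%:R - k%:R = (c - k%:R + e%:R) - (c - k'%:R) :> F by ring.
    by rewrite (eqP kE) subrr.
  by rewrite eqr_nat => /eqP kE'; move: ke; rewrite -kE' ltnNge leq_addr.
have xE' : rho (offset_part d X) *m x = \sum_(k < N - e) g' k.
  rewrite xE mulmx_sumr -(big_mkord xpredT (fun k => rho (offset_part d X) *m g k)).
  rewrite -(big_mkord xpredT g'); case: (leqP e N) => [eN|Ne].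
    rewrite (big_cat_nat (leq0n e) eN) /= big_nat big1 ?add0r => [|k /andP[_]]; last exact: low.
    by rewrite -{1}[e]add0n big_addn.
  rewrite (eqP (ltnW Ne : (N - e == 0)%N)) [RHS]big_geq // big_nat big1 // => k /andP[_ kN].
  by apply: low; exact: ltn_trans Ne.
case: (ltnP 0 N) => [N0|]; last first.
  by rewrite leqn0 => /eqP N0; move: x0; rewrite xE N0 big_ord0 eqxx.
apply: (IH (N - e)%N _ g' (rho (offset_part d X) *m x)) => //; first by lia.
  by apply: Ist => //; exact: offset_part_nplus.
move=> k; rewrite /g' hE; congr (_ *: _); rewrite natrD; ring.
Qed.

Lemma tensor_summand_coords (mu nu : weight r) (f g : nat -> F) : tensor_summand F mu nu (@omega1 r) ->
  eps_coords mu f -> eps_coords nu g ->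
  (forall i, (i < r)%N -> (f i - g i) ^+ 3 = f i - g i) /\
  (forall i j, (i < r)%N -> (j < r)%N -> i != j -> (f i - g i) * (f j - g j) = 0).
Proof.
case=> n [m [p [rho [sigma [tau [[rhoP rsimp [v v0 [nv cv]]] irrS [tauP tsimp [x x0 [nx cx]]]
  [A [B [AE BE BA]]]]]]]]] cf cg.
pose w := A *m x.
have w0 : w != 0.
  by apply: contra x0 => /eqP w0; rewrite -[x]mul1mx -BA -mulmxA -/w w0 mulmx0.
pose W := tensor_mx w.
have W0 : W != 0 by apply: contra w0 => /eqP/tensor_mx_inj->.
have actE X : X \in so -> rho X *m W + W *m (sigma X)^T = tensor_mx (A *m (tau X *m x)).
  by move=> sX; rewrite -tensor_mx_action /w !mulmxA AE.
have nW X : X \in @so_nplus F r -> rho X *m W = - (W *m (sigma X)^T).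
  move=> nX; apply/eqP; rewrite -addr_eq0 actE ?nplus_so // nx // mulmx0.
  by apply/eqP/matrixP => i j; rewrite !mxE.
have hW i : (i < r)%N -> rho (h i) *m W + W *m (sigma (h i))^T = f i *: W.
  move=> ir; rewrite actE; last by apply: cartan_so; lia.
  rewrite (hw_cartan cf cx ir) -scalemxAr -/w -[_ *: w]addr0 tensor_mx_lin.
  by rewrite [tensor_mx 0](_ : _ = 0) ?addr0 //; apply/matrixP => a b; rewrite !mxE.
have [c sv] := hw_singular nv cv.
have lv : line v v by exists 1; rewrite scale1r.
have spanV := simple_word_span rhoP rsimp sv v0 lv.
have [phi Wphi] : exists phi : 'cV[F]_m, W *m phi != 0.
  apply: NNPP => none; case/eqP: W0; apply/matrixP => i j; rewrite mxE.
  apply/eqP/negPn/negP => Wij; apply: none; exists (delta_mx j 0); rewrite -colE.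
  by apply: contra Wij => /eqP/matrixP/(_ i 0); rewrite !mxE => ->.
have [|y [[psi yE] y0 ny]] := @nplus_invariant_singular n rho c (line v)
    (fun u => exists psi, u = W *m psi) (W *m phi) rhoP sv spanV _ (ex_intro _ phi erefl) Wphi.
  move=> X _ nX [psi ->]; exists (- ((sigma X)^T *m psi)).
  by rewrite mulmxA nW // mulNmx mulmxN mulmxA.
have [a yv] := singular_line rhoP rsimp sv v0 ny.
have hv i : (i < r)%N -> rho (h i) *m y = g i *: y.
  by move=> ir; rewrite yv -scalemxAr (hw_cartan cg cv ir) !scalerA mulrC.
(* Each transposed [sigma (h i)] inserted after W multiplies the result by f_i - g_i, so relations
   among the h_i become relations among these differences. *)
have step i b (u : 'cV[F]_m) : (i < r)%N -> W *m u = b *: y ->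
    W *m ((sigma (h i))^T *m u) = ((f i - g i) * b) *: y.
  move=> ir Wu; have /(congr1 (mulmx^~ u)) := hW i ir.
  rewrite /= mulmxDl -[rho _ *m W *m u]mulmxA -scalemxAl Wu -scalemxAr hv // mulmxA.
  move=> /eqP; rewrite addrC eq_sym -subr_eq => /eqP <-.
  by rewrite !scalerA -scalerBl mulrBl [b * g i]mulrC.
have Wpsi : W *m psi = 1 *: y by rewrite scale1r.
have [cube prod0] := irrep_omega1_cartan r2 irrS.
have cancel_y (s t : F) : s *: y = t *: y -> s = t.
  move=> /eqP; rewrite -subr_eq0 -scalerBl scaler_eq0 (negPf y0) orbF subr_eq0.
  by move/eqP.
split=> [i ir|i j ir jr ij]; apply: cancel_y.
  have s1 := step i _ _ ir Wpsi; have s2 := step i _ _ ir s1; have s3 := step i _ _ ir s2.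
  rewrite -[f i - g i in RHS]mulr1 -s1 -[in RHS](cube i ir) !trmx_mul.
  by rewrite !exprS expr0 -s3 -!mulmxA.
have s1 := step i _ _ ir Wpsi; have s2 := step j _ _ jr s1.
rewrite -[X in (_ * X) *: _]mulr1 [X in X *: _](_ : _ = (f j - g j) * ((f i - g i) * 1)); last by ring.
by rewrite -s2 mulmxA -trmx_mul prod0 // trmx0 mul0mx mulmx0 scale0r.
Qed.

End Tensor.

(** * Admissible tuples *)

Section Shape.
Variables (F : numFieldType) (r : nat) (lam l : 'I_r -> nat).
Hypothesis r2 : (2 <= r)%N.

(** The value 1 at index 0 encodes omega_1 = eps_1: the coordinates of omega_1 minus the sum of the
    l_j alpha_j become differences of consecutive values. *)
Definition multiplicity (i : nat) : nat := if i is 0 then 1 else at1 0%N l i.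
Local Notation L := multiplicity.

Lemma sum_at1 (i : nat) (x : 'I_r -> nat) :
  (\sum_(j < r | j == i :> nat) x j = at1 0 x i.+1)%N.
Proof.
rewrite /at1; case: insubP => [j ir ij|ir] /=.
  by rewrite (big_pred1 j) // => a; rewrite -ij val_eqE.
by rewrite big_pred0 // => j; apply/eqP => ji; move: ir; rewrite -ji ltn_ord.
Qed.

Lemma sum_simple_root (i : 'I_r) :
  \sum_j (l j)%:Z * simple_root j i =
  2 * (L i.+1)%:Z - (if i.+1 == r then 2 else 1) * (if (i : nat) == 0%N then 0 else (L i)%:Z)
  - (L i.+2)%:Z.
Proof.
transitivity (\sum_(j < r) ((if j == i :> nat then 2 * (l j)%:Z else 0) +
   (if (j.+1 == i :> nat) then - (if i.+1 == r then 2 else 1) * (l j)%:Z else 0) -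
   (if j == i.+1 :> nat then (l j)%:Z else 0))).
  apply: eq_bigr => j _; rewrite /simple_root -val_eqE /= [(i : nat) == j]eq_sym.
  have [->|ji] := eqVneq (j : nat) i.
    by rewrite (gtn_eqF (ltnSn i)) (ltn_eqF (ltnSn i)) addr0 subr0 mulrC.
  rewrite [(i : nat) == j.+1]eq_sym add0r; have [ji1|_] := eqVneq j.+1 (i : nat).
    rewrite (_ : (j == i.+1 :> nat) = false) ?subr0; last by lia.
    by case: ifP => _; ring.
  by rewrite add0r; case: ifP => _; ring.
have sumZ (P : pred 'I_r) : \sum_(j | P j) (l j)%:Z = (\sum_(j | P j) l j)%N%:Z.
  by rewrite (big_morph Posz PoszD erefl).
rewrite sumrB big_split /= -!big_mkcond /= -!mulr_sumr !sumZ !sum_at1 mulNr.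
congr (_ - _ * _ - _); case: eqP => [->|/eqP i0]; first by rewrite big_pred0.
have -> : L i = at1 0%N l i.-1.+1.
  by rewrite prednK ?lt0n // /multiplicity; case: (nat_of_ord i) i0.
rewrite -sum_at1.
by congr (_%:Z); apply: eq_bigl => j; lia.
Qed.

Lemma summand_coords g : eps_coords (dominant_weight lam) g ->
  eps_coords (fun i => (lam i)%:Z + @omega1 r i - \sum_j (l j)%:Z * simple_root j i)
    (fun i => g i + ((L i)%:R - (L i.+1)%:R) : F).
Proof.
move=> cg i; have := cg i; rewrite sum_simple_root /dominant_weight /omega1.
have int1 (b : bool) : (b%:Z)%:~R = b%:R :> F by [].
case: eqP => ir gE.
  have -> : ((i : nat) == 0%N) = false by lia.
  have -> : L i.+2 = 0%N by rewrite /multiplicity /at1 insubF // ir ltnn.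
  rewrite mulrnDl gE; move: (L i) (L i.+1) => a b.
  by rewrite !(rmorphB, rmorphD, rmorphM) /= -!pmulrn; ring.
have -> : g i + ((L i)%:R - (L i.+1)%:R) - (g i.+1 + ((L i.+1)%:R - (L i.+2)%:R)) =
  g i - g i.+1 + (L i)%:R - (L i.+1)%:R *+ 2 + (L i.+2)%:R :> F by ring.
rewrite gE; case: eqP => [->|_].
  rewrite {1}/multiplicity; move: (L 1) (L 2) => b c.
  by rewrite !(rmorphB, rmorphD, rmorphM) /= -!pmulrn; ring.
move: (L i) (L i.+1) (L i.+2) => a b c.
by rewrite !(rmorphB, rmorphD, rmorphM) /= -!pmulrn; ring.
Qed.

(** Consecutive differences d satisfy d^3 = d, and at most one is nonzero. Starting from 1, the
    multiplicities stay 1 or jump once, to 0 or 2. *)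
Lemma admissible_shape : admissible F lam l ->
  (forall a, l a = 1%N) \/
  exists2 k : nat, (k < r)%N &
    exists2 e : nat, e = 0%N \/ e = 2 & forall a : 'I_r, l a = if (a < k)%N then 1%N else e.
Proof.
move=> adm; have [g cg] := eps_coords_exists F (dominant_weight lam).
have [cube prod0] := tensor_summand_coords r2 adm (summand_coords cg) cg.
have LE (a : 'I_r) : l a = L a.+1 by rewrite /multiplicity at1E.
have dE i : g i + ((L i)%:R - (L i.+1)%:R) - g i = (L i)%:R - (L i.+1)%:R :> F by ring.
have stepL i : (i < r)%N -> [\/ L i = L i.+1, L i = (L i.+1).+1 | L i.+1 = (L i).+1].
  move=> ir; have := cube i ir; rewrite dE; set d := _ - _ => d3.
  have /eqP : d * ((d - 1) * (d + 1)) = 0.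
    by apply/eqP; rewrite -(subrr (d ^+ 3)) {2}d3; apply/eqP; ring.
  rewrite !mulf_eq0 => /or3P[]; rewrite /d.
  - by rewrite subr_eq0 eqr_nat => /eqP E; exact: Or31.
  - rewrite subr_eq0 subr_eq nat1r eqr_nat => /eqP E; exact: Or32.
  - rewrite addrAC subr_eq0 natr1 eqr_nat => /eqP E; exact: Or33.
have oneL i j : (i < r)%N -> (j < r)%N -> i != j -> L i = L i.+1 \/ L j = L j.+1.
  move=> ir jr ij; have /eqP := prod0 i j ir jr ij; rewrite !dE mulf_eq0.
  by rewrite !subr_eq0 !eqr_nat => /orP[] /eqP; [left|right].
case: (classic (exists2 k, (k < r)%N & L k <> L k.+1)) => [[k kr Lk]|none]; last first.
  left; have L1 i : (i <= r)%N -> L i = 1%N.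
    elim: i => // i IH ir; rewrite -(IH (ltnW ir)).
    by case: (classic (L i = L i.+1)) => // ne; case: none; exists i.
  by move=> a; rewrite LE L1.
right; exists k => //.
have Leq i : (i < r)%N -> i != k -> L i = L i.+1.
  by move=> ir ik; case: (oneL i k ir kr ik).
have low i : (i <= k)%N -> L i = 1%N.
  elim: i => // i IH ik; rewrite -(IH (ltnW ik)).
  by rewrite [RHS]Leq ?(ltn_trans ik kr) // ltn_eqF.
have high i : (k < i)%N -> (i <= r)%N -> L i = L k.+1.
  elim: i => // i IH; rewrite ltnS leq_eqVlt => /orP[/eqP<-//|ki] ir.
  by rewrite -(IH ki (ltnW ir)) [RHS]Leq // gtn_eqF.
exists (L k.+1).
  by have Lk1 := low k (leqnn k); case: (stepL k kr) => E; lia.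
move=> a; rewrite LE; case: ltnP => [ak|ka]; first exact: low.
by apply: high.
Qed.

End Shape.

(** * Matching the exponents for the two shapes of l *)

Section Conclusion.
Variables (F : numFieldType) (r : nat) (lam l : 'I_r -> nat).
Hypothesis r2 : (2 <= r)%N.
Variables (L : nat) (c : 'I_L -> 'I_r) (t : 'I_L -> F) (y : 'I_r -> {poly F}).
Hypothesis colors : coloring l c.
Hypothesis bethe : bethe_solution
   (fun s : 'I_2 => if s == ord0 then dominant_weight lam else @omega1 r)
   (fun s : 'I_2 => if s == ord0 then 0 else 1) c t.
Hypothesis repr_y : represents c t y.
Local Notation la := (at1 0%N lam).
Local Notation Y := (extended_tuple y).

Lemma size_color_roots a : size (color_roots c t a) = l a.
Proof. by rewrite size_map -cardE; case: colors => _ <-. Qed.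

Lemma size_extended_tuple (a : 'I_r) : size (Y a.+1) = (l a).+1.
Proof. by rewrite (extended_tuple_roots repr_y) size_prod_XsubC size_color_roots. Qed.

Lemma extended_tuple_neq0 i : Y i != 0.
Proof.
case: i => [|i]; first by rewrite /= -[1]/(1%:P) polyXsubC_eq0.
case: (ltnP i r) => [ir|ri].
  by rewrite -size_poly_eq0 (size_extended_tuple (Ordinal ir)).
by rewrite /extended_tuple /at1 insubF ?oner_eq0 // ltnNge ri.
Qed.

Lemma extended_tuple_linear (a : 'I_r) : l a = 1%N -> Y a.+1 = 'X - (- (Y a.+1)`_0)%:P.
Proof.
move=> la1; have := size_color_roots a; rewrite la1.
rewrite (extended_tuple_roots repr_y); case: (color_roots c t a) => [|x [|]] //= _.
by rewrite big_seq1 coefB coefX coefC /= sub0r opprK.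
Qed.

Lemma extended_tuple_one i : (r <= i)%N -> Y i.+1 = 1.
Proof. by move=> ri; rewrite /extended_tuple /at1 insubF // ltnNge ri. Qed.

Lemma Dlambda_extended : Dlambda lam (fun i => (y i)%:F) = Dlambda lam (ratfun_tuple Y).
Proof.
by congr (Dlambda lam _); apply: boolp.funext => i; rewrite /ratfun_tuple /extended_tuple at1E.
Qed.

Lemma low_linear k (lk : forall a : 'I_r, (a < k)%N -> l a = 1%N) : (k <= r)%N ->
  forall i, (i <= k)%N -> Y i = 'X - (- (Y i)`_0)%:P.
Proof.
move=> kr [_|i ik]; first by rewrite /= coefB coefX coef1 sub0r opprK.
have ir : (i < r)%N := leq_trans ik kr.
by apply: (extended_tuple_linear (a := Ordinal ir)); apply: lk.
Qed.

Lemma Dlambda_powers (B : nat -> nat) (e : 'I_r -> nat) :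
  (forall i : 'I_r, B i.+1 = e i) ->
  Dlambda lam (@ratfun_tuple F r (fun i => 'X^(B i))) = Dlambda lam (fun i => ('X ^+ e i)%:F).
Proof.
by move=> Be; congr (Dlambda lam _); apply: boolp.funext => i; rewrite /ratfun_tuple Be.
Qed.

Lemma Dlambda_short k : (k < r)%N -> (forall a : 'I_r, l a = if (a < k)%N then 1%N else 0%N) ->
  Dlambda lam (fun i => (y i)%:F) = Dlambda lam (fun i => ('X ^+ exponent lam k i)%:F).
Proof.
move=> kr lE; rewrite Dlambda_extended.
pose B i := at1 0%N (exponent lam k) i.
rewrite -(Dlambda_powers (B := B)); last by move=> i; rewrite /B at1E.
have lk (a : 'I_r) : (a < k)%N -> l a = 1%N by rewrite lE => ->.
apply: (bethe_linear_chain r2 (bethe_tuple_extended r2 bethe repr_y) kr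
  (low_linear lk (ltnW kr))).
- case=> // i ki; case: (ltnP i r) => [ir|]; last exact: extended_tuple_one.
  have l0 : l (Ordinal ir) = 0%N by rewrite lE /= ltnNge -ltnS ki.
  have := size_color_roots (Ordinal ir); rewrite l0.
  have -> : Y i.+1 = \prod_(x <- color_roots c t (Ordinal ir)) ('X - x%:P).
    exact: (extended_tuple_roots repr_y (Ordinal ir)).
  by case: (color_roots c t (Ordinal ir)) => // _; rewrite big_nil.
- case=> // i /andP[_ ik]; have ir : (i < r)%N := ltn_trans ik kr.
  have BE j : (j < r)%N -> B j.+1 =
      if (j < k)%N then (\sum_(j.+1 <= b < k.+1) la b + (k.+1 - j.+1))%N else 0%N.
    by move=> jr; rewrite /B (at1E _ _ (Ordinal jr)) /exponent kr /=.
  rewrite BE // ik; have [ki|ki] := ltnP i.+1 k.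
    by rewrite (BE i.+1 (ltn_trans ki kr)) ki big_ltn ?ltnS //; lia.
  have -> : B i.+2 = 0%N.
    case: (ltnP i.+1 r) => ir1; first by rewrite BE // ltnNge ki.
    by rewrite /B /at1 insubF // ltnNge ir1.
  have -> : k = i.+1 by lia.
  by rewrite big_nat1; lia.
- case=> // i ki; case: (ltnP i r) => ir.
    by rewrite /B (at1E _ _ (Ordinal ir)) /exponent kr /= ltnNge -ltnS ki.
  by rewrite /B /at1 insubF // ltnNge ir.
Qed.

Lemma Dlambda_long k : (k < r)%N -> (forall a : 'I_r, l a = if (a < k)%N then 1%N else 2) ->
  Dlambda lam (fun i => (y i)%:F) =
  Dlambda lam (fun i => ('X ^+ exponent lam (r.*2 - k) i)%:F).
Proof.
move=> kr lE; rewrite Dlambda_extended.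
pose S := (2 * \sum_(k.+1 <= j < r) la j + la r)%N.
pose B i := if (i <= k)%N then (\sum_(i <= j < k.+1) la j + S + (r.*2 - k - i))%N
            else (S + (r.*2 - k.*2 - 1))%N.
rewrite -(Dlambda_powers (B := B)); last first.
  move=> i; rewrite /B /exponent (_ : (r.*2 - k < r)%N = false); last by lia.
  rewrite (_ : (r.*2 - (r.*2 - k) = k)%N); last by lia.
  by rewrite /S !addnA.
have lk (a : 'I_r) : (a < k)%N -> l a = 1%N by rewrite lE => ->.
apply: (bethe_quadratic_chain r2 (bethe_tuple_extended r2 bethe repr_y) kr
  (low_linear lk (ltnW kr))).
- case=> // i /andP[ki ir]; rewrite (size_extended_tuple (Ordinal ir)) lE /=.
  by rewrite ltnNge -ltnS ki.
- exact: extended_tuple_neq0.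
- move=> i /andP[i0 ik]; rewrite /B ik; have [ki|ki] := ltnP i k.
    by rewrite big_ltn ?ltnS //; lia.
  have -> : i = k by lia.
  by rewrite big_nat1; lia.
(* The r - 1 - k summands 1 of m_(r-1), doubled and increased by 1, give 2r - 2k - 1. *)
- move=> i ki; rewrite /B leqNgt ki /= /lowest_exponent prednK; last by lia.
  under eq_bigr do rewrite -addn1.
  rewrite big_split sum_nat_const_nat muln1 /= /S; lia.
Qed.

End Conclusion.

Lemma sum_shape r k e (l : 'I_r -> nat) : (k <= r)%N ->
  (forall a : 'I_r, l a = if (a < k)%N then 1%N else e) ->
  (\sum_a l a = k + (r - k) * e)%N.
Proof.
move=> kr lE; rewrite (eq_bigr _ (fun a _ => lE a)).
rewrite -(big_mkord xpredT (fun a => if (a < k)%N then 1%N else e)).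
rewrite (big_cat_nat (leq0n k) kr) /= big_nat (eq_bigr (fun=> 1%N)); last first.
  by move=> a /andP[_ ->].
rewrite -big_nat sum_nat_const_nat subn0 muln1; congr (_ + _)%N.
rewrite big_nat (eq_bigr (fun=> e)); last by move=> a /andP[ka _]; rewrite ltnNge ka.
by rewrite -big_nat sum_nat_const_nat.
Qed.

Theorem proposition3p11 (R : realType) (r : nat) (hr : (2 <= r)%N)
  (lam l : 'I_r -> nat)
  (hadm : admissible R[i] lam l)
  (hlen : (\sum_a l a)%N <> r)
  (c : 'I_(\sum_a l a)%N -> 'I_r) (hc : coloring l c)
  (t : 'I_(\sum_a l a)%N -> R[i])
  (ht : bethe_solution
          (fun s : 'I_2 => if s == ord0 then dominant_weight lam
                           else @omega1 r)
          (fun s : 'I_2 => if s == ord0 then 0 else 1)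
          c t)
  (y : 'I_r -> {poly R[i]}) (hy : represents c t y) :
  Dlambda lam (fun i => (y i)%:F) =
  Dlambda lam (fun i => ('X ^+ exponent lam (\sum_a l a)%N i)%:F).
Proof.
case: (admissible_shape hr hadm) => [l1|[k kr [e [e0|e2] lE]]].
(* The constant tuple 1 has the excluded length r. *)
- case: hlen; rewrite (sum_shape (k := r) (e := 0) (leqnn r)) ?subnn ?addn0 //.
  by move=> a; rewrite ltn_ord.
- apply: (etrans (Dlambda_short hr hc ht hy kr _)); first by rewrite e0 in lE.
  by rewrite (sum_shape (ltnW kr) lE) e0 muln0 addn0.
- apply: (etrans (Dlambda_long hr hc ht hy kr _)); first by rewrite e2 in lE.
  rewrite (sum_shape (ltnW kr) lE) e2 (_ : (k + (r - k) * 2 = r.*2 - k)%N) //.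
  by lia.
Qed.
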